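(* Let $a,b,c,\alpha\in\mathbb{R}$ with $c>0$ and $1/2<\alpha<1$. If $$|b|<a+\frac{\cos^2(\alpha\pi/2)\sec(\alpha\pi)}{4c},$$ then the stability of the equation $D^{\alpha}x(t)+c\,D^{2\alpha}x(t)=a\,x(t)+b\,x(t-\tau)$ is independent of the delay $\tau$.
   Context: $D^{\mu}$ denotes the Caputo fractional derivative (base point $0$) in $t$: for $m\in\mathbb{N}$ and $m-1<\mu<m$, $D^{\mu}f(t)=\frac{1}{\Gamma(m-\mu)}\int_0^t (t-s)^{m-\mu-1}f^{(m)}(s)\,ds$, and $D^{m}f=f^{(m)}$. The equation is considered for $t>0$ with delay $\tau\ge 0$ and a prescribed history on $[-\tau,0]$ (together with a prescribed value $x'(0)$ since $1<2\alpha<2$). Characteristic equation: $\lambda^{\alpha}+c\lambda^{2\alpha}=a+b\,e^{-\lambda\tau}$ (principal branch of powers). Stability: for a given $\tau\ge0$ the equation is called stable if all its solutions are bounded as $t\to\infty$, and unstable if it is not stable. ''The stability is independent of the delay $\tau$'' means: if the equation with $\tau=0$, i.e. $D^{\alpha}x(t)+c\,D^{2\alpha}x(t)=(a+b)x(t)$, is stable (respectively, unstable), then the delayed equation is stable (respectively, unstable) for all $\tau\ge 0$. *)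

(* Defs.v *)
From HB Require Import structures.
From mathcomp Require Import all_boot all_order all_algebra.
From mathcomp Require Import all_classical all_reals all_analysis.

Set Implicit Arguments.
Unset Strict Implicit.
Unset Printing Implicit Defensive.

Import Order.TTheory GRing.Theory Num.Theory.
Import numFieldNormedType.Exports.

Local Open Scope classical_set_scope.
Local Open Scope ring_scope.

(* Euler's Gamma function; the integral converges exactly for z > 0. *)
Definition Gamma (R : realType) (z : R) : R :=
  \int[lebesgue_measure]_(u in `]0, +oo[) (u `^ (z - 1) * expR (- u)).

(* The natural number m with m - 1 < mu <= m, for mu > 0. *)
Definition caputo_order (R : realType) (mu : R) : nat := `|Num.ceil mu|%N.

Definition caputo_integrand (R : realType) (mu : R) (f : R -> R) (t s : R) : R :=
  let m := caputo_order mu in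
  (t - s) `^ (m%:R - mu - 1) * derive1n m f s.

(* Caputo derivative of order mu > 0 with base point 0, at t > 0. Only the
   restriction of f to the positive half-line matters, so the two-sided
   derivatives f^(m)(s) = derive1n m f s are the intended ones. *)
Definition caputo (R : realType) (mu : R) (f : R -> R) (t : R) : R :=
  let m := caputo_order mu in
  if mu == m%:R then derive1n m f t
  else (Gamma (m%:R - mu))^-1 *
       \int[lebesgue_measure]_(s in `]0, t[) caputo_integrand mu f t s.

(* The derivatives and integrals of the library are total functions with junk
   values; this predicate says that f is m times differentiable on the positive
   half-line and that the defining integral of its Caputo derivative converges
   (absolutely) at every t > 0. *)
Definition caputo_differentiable (R : realType) (mu : R) (f : R -> R) : Prop :=
  let m := caputo_order mu in
  (forall (k : nat) (s : R), (k < m)%N -> 0 < s -> derivable (derive1n k f) s 1) /\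
  (mu != m%:R -> forall t : R, 0 < t ->
     lebesgue_measure.-integrable `]0, t[ (EFin \o caputo_integrand mu f t)).

(* x solves D^alpha x(t) + c D^(2 alpha) x(t) = a x(t) + b x(t - tau) for t > 0,
   with history phi on [-tau, 0] and initial slope x1 = x'(0). Since x is
   unconstrained by the equation on t <= 0, x'(0) is the right derivative.
   Values of x to the left of -tau are irrelevant. *)
Definition is_solution (R : realType) (a b c alpha tau : R)
    (phi : R -> R) (x1 : R) (x : R -> R) : Prop :=
  [/\ forall t : R, - tau <= t <= 0 -> x t = phi t,
      {within `[0, +oo[, continuous x},
      (h^-1 * (x h - x 0)) @[h --> 0^'+] --> x1,
      caputo_differentiable alpha x /\ caputo_differentiable (2 * alpha) x
    & forall t : R, 0 < t ->
        caputo alpha x t + c * caputo (2 * alpha) x t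
          = a * x t + b * x (t - tau)].

Definition stable (R : realType) (a b c alpha tau : R) : Prop :=
  forall (phi : R -> R) (x1 : R) (x : R -> R),
    {within `[- tau, 0], continuous phi} ->
    is_solution a b c alpha tau phi x1 x ->
    bounded_near x (pinfty_nbhs R).

Definition unstable (R : realType) (a b c alpha tau : R) : Prop :=
  ~ stable a b c alpha tau.

Definition stability_delay_independent (R : realType) (a b c alpha : R) : Prop :=
  (stable a b c alpha 0 -> forall tau : R, 0 <= tau -> stable a b c alpha tau) /\
  (unstable a b c alpha 0 ->
     forall tau : R, 0 <= tau -> unstable a b c alpha tau).

(* Main.v *)
(* Since cos (alpha pi) < 0, the hypothesis forces |b| < a, and the
   characteristic function lam^alpha + c lam^(2 alpha) - a - b e^(-lam tau)
   changes sign on the positive half-line: for every delay there is a real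
   characteristic root lam > 0. So the equation is unstable for every tau >= 0,
   which settles both halves of delay independence.

   Instability is witnessed by the solution x with zero history and x'(0) = 1.
   It solves x = t + (a/c) I^(2 alpha) x + (b/c) I^(2 alpha) x(. - tau)
   - (1/c) I^alpha x, and the Neumann series of this Volterra equation is a sum
   of truncated powers (t - j tau)_+^p / Gamma(p + 1), on which fractional
   integrals act by p |-> p + mu (the Beta-Gamma identity). With the weight
   e^(kt), k large, the series converges geometrically. If x were bounded, its
   Laplace transform X would exist at lam, and the Volterra equation there reads
   X(lam) = lam^(-2) + X(lam), which is absurd. *)

Require Import Defs.
From HB Require Import structures.
From mathcomp Require Import all_boot all_order all_algebra.
From mathcomp Require Import all_classical all_reals all_analysis.
From mathcomp Require Import measurable_realfun.
From mathcomp Require Import ring lra.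

Set Implicit Arguments.
Unset Strict Implicit.
Unset Printing Implicit Defensive.

Import Order.TTheory GRing.Theory Num.Theory.
Import numFieldNormedType.Exports.

Local Open Scope classical_set_scope.
Local Open Scope ring_scope.

(** * Affine substitution in Lebesgue integrals *)

Section affine_change_of_variables.
Context {R : realType}.
Notation mu := (@lebesgue_measure R).

Lemma measurable_affine (k u : R) :
  measurable_fun [set: R] (fun x : R => k * x + u).
Proof.
apply: measurable_funD; last exact: measurable_cst.
by apply: measurable_funM; [exact: measurable_cst|exact: measurable_id].
Qed.

(** [k] times the image of Lebesgue measure under [k * x + u] gives each interval []a, b]] its
    length, so it is Lebesgue measure by uniqueness. *)
Lemma ge0_integral_affine (k u : R) (f : R -> \bar R) : 0 < k ->
  measurable_fun setT f -> (forall x, (0 <= f x)%E) ->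
  (\int[mu]_x f x = k%:E * \int[mu]_x f (k * x + u)%R)%E.
Proof.
move=> k0 mf f0.
pose phi : measurableTypeR R -> measurableTypeR R := fun x => k * x + u.
have mphi : measurable_fun setT phi by exact: measurable_affine.
pose m' : {measure set (measurableTypeR R) -> \bar R} :=
  mscale (NngNum (ltW k0)) (pushforward mu phi).
pose m := m' mphi.
have mE A : measurable A -> mu A = m A.
  apply: lebesgue_measure_unique => X [[a b] _ <-] /=.
  rewrite /m /m' /mscale /= /pushforward /=.
  have -> : phi @^-1` `]a, b] = `]((a - u) / k), ((b - u) / k)]%classic.
    apply/seteqP; split=> x; rewrite /phi /= !in_itv /= => /andP[h1 h2];
      apply/andP; split.
    + by rewrite ltr_pdivrMr// ltrBlDr mulrC.
    + by rewrite ler_pdivlMr// lerBrDr mulrC.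
    + by move: h1; rewrite ltr_pdivrMr// ltrBlDr mulrC.
    + by move: h2; rewrite ler_pdivlMr// lerBrDr mulrC.
  rewrite !lebesgue_measure_itv /= !lte_fin.
  rewrite ltr_pM2r ?invr_gt0// ltrD2r.
  case: ifP => _; last by rewrite mule0.
  by rewrite -!EFinB -EFinM; congr EFin; field; rewrite gt_eqF.
transitivity (\int[m]_x f x)%E.
  by apply: eq_measure_integral => A mA _; exact: mE.
rewrite /m /m' ge0_integral_mscale//=.
by rewrite ge0_integral_pushforward.
Qed.

End affine_change_of_variables.

(** * Truncated powers and their Laplace transforms *)

Section truncated_powers.
Context {R : realType}.
Notation mu := (@lebesgue_measure R).
Implicit Types p t k z : R.

(** The truncated power t_+^p. The explicit cut at 0 overrides the default values of [powR] at
    nonpositive bases, so that whole-line convolutions of such functions reduce to integrals over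
    []0, t[]. *)
Definition pospow p t : R := if 0 < t then t `^ p else 0.

Lemma pospow_ge0 p t : 0 <= pospow p t.
Proof. by rewrite /pospow; case: ifP => // _; exact: powR_ge0. Qed.

Lemma pospow_le0 p t : t <= 0 -> pospow p t = 0.
Proof. by rewrite /pospow leNgt => /negbTE ->. Qed.

Lemma pospow_gt0 p t : 0 < t -> pospow p t = t `^ p.
Proof. by rewrite /pospow => ->. Qed.

Lemma measurable_pospow p : measurable_fun [set: R] (pospow p).
Proof.
apply: measurable_fun_ifT; last exact: measurable_cst.
  by apply: measurable_fun_ltr; [exact: measurable_cst|exact: measurable_id].
exact: measurable_powR.
Qed.

Lemma measurable_pospow_comp d (T : measurableType d) p (f : T -> R) :
  measurable_fun setT f -> measurable_fun setT (fun x => pospow p (f x)).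
Proof. by move=> mf; exact: (measurableT_comp (measurable_pospow p) mf). Qed.

Lemma pospowZ p k t : 0 < k -> pospow p (k * t) = k `^ p * pospow p t.
Proof.
move=> k0; rewrite /pospow pmulr_rgt0//.
case: ifPn => t0; last by rewrite mulr0.
by rewrite powRM// ltW.
Qed.

(** Integrating over the whole line allows free translations; on functions vanishing for t <= 0 this
    is the usual one-sided transform. *)
Definition laplace (lam : R) (f : R -> R) : \bar R :=
  (\int[mu]_t (expR (- (lam * t)) * f t)%:E)%E.

Lemma measurable_expRN (lam : R) :
  measurable_fun [set: R] (fun t => expR (- (lam * t))).
Proof.
apply: (measurableT_comp (@measurable_expR R)).
apply: measurable_funN; apply: measurable_funM; last exact: measurable_id.
exact: measurable_cst.
Qed.

Lemma measurable_laplace (lam : R) (f : R -> R) : measurable_fun setT f ->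
  measurable_fun setT (fun t => (expR (- (lam * t)) * f t)%:E).
Proof.
move=> mf; apply/measurable_EFinP.
by apply: measurable_funM; [exact: measurable_expRN|exact: mf].
Qed.

(** Substitute [lam * t] for [t] in the transform at 1. *)
Lemma laplace_pospow (lam p : R) : 0 < lam ->
  laplace lam (pospow p) =
  ((lam `^ (- (p + 1)))%:E * laplace 1 (pospow p))%E.
Proof.
move=> l0; rewrite /laplace.
rewrite [in RHS](ge0_integral_affine 0 l0); last 2 first.
- by apply: measurable_laplace; exact: measurable_pospow.
- by move=> x; rewrite lee_fin mulr_ge0 ?expR_ge0 ?pospow_ge0.
have E t : (expR (- (1 * (lam * t + 0))) * pospow p (lam * t + 0))%:E =
  ((lam `^ p)%:E * (expR (- (lam * t)) * pospow p t)%:E)%E.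
  by rewrite mul1r addr0 pospowZ// -EFinM mulrCA.
under [in RHS]eq_integral do rewrite E.
rewrite ge0_integralZl_EFin//; last 3 first.
- by move=> x _; rewrite lee_fin mulr_ge0 ?expR_ge0 ?pospow_ge0.
- by apply: measurable_laplace; exact: measurable_pospow.
- exact: powR_ge0.
rewrite !muleA -!EFinM -[X in X * lam]mulr1.
have -> : lam `^ (- (p + 1)) * 1 * lam * lam `^ p = 1.
  rewrite mulr1 -mulrA powRN.
  rewrite -{2}[lam]powRr1 ?ltW// -powRD ?(gt_eqF l0) ?implybT//.
  by rewrite addrC mulVf// gt_eqF// powR_gt0// addrC.
by rewrite mul1e.
Qed.

Lemma GammaE_laplace z : Gamma z = fine (laplace 1 (pospow (z - 1))).
Proof.
rewrite /Gamma /Rintegral /laplace integral_mkcond; congr fine.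
apply: eq_integral => t _ /=; rewrite patchE.
case: ifPn; rewrite ?inE ?notin_setE /= in_itv /= andbT.
  by move=> t0; rewrite pospow_gt0// mul1r mulrC.
by move=> /negP; rewrite -leNgt => t0; rewrite pospow_le0// mulr0.
Qed.

Lemma integral_expRN_itvcy (T k : R) : 0 < k ->
  (\int[mu]_(u in `[T, +oo[) (expR (- (k * u)))%:E)%E = (k^-1 * expR (- (k * T)))%:E.
Proof.
move=> k0.
have dF (x : R) : is_derive x 1 (fun u => - (k^-1 * expR (- (k * u))))
   (expR (- (k * x))).
  have d1 : is_derive x (1 : R) (fun u : R => - (k * u)) (- k).
    have -> : (fun u : R => - (k * u)) = - (k *: (@id R)) by [].
    by apply: is_derive_eq; rewrite /GRing.scale /= mulr1.
  have d2 := is_deriveN (is_deriveZ k^-1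
    (@is_derive1_comp _ expR (fun u : R => - (k * u)) x _ _ (is_derive_expR _) d1)).
  apply: (is_derive_eq d2).
  by rewrite /GRing.scale /=; field; rewrite gt_eqF.
rewrite (@ge0_continuous_FTC2y _ _ (fun u => - (k^-1 * expR (- (k * u)))) T 0).
- by rewrite sub0e -EFinN opprK.
- by move=> x _; exact: expR_ge0.
- apply: continuous_subspaceT => x.
  apply: (@continuous_comp _ _ _ (fun u : R => - (k * u)) expR).
    by apply: cvgN; apply: cvgMr; exact: cvg_id.
  exact: continuous_expR.
- rewrite -oppr0 -(mulr0 k^-1); apply: cvgN; apply: cvgMr.
  have -> : (fun x : R => expR (- (k * x))) =
     (fun x : R => expR (- x)) \o (fun x => k * x) by [].
  apply: (@cvg_comp _ _ _ _ _ _ (pinfty_nbhs R)); last exact: cvgr_expR.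
  by apply: gt0_cvgMry => //; exact: cvg_id.
- by move=> x _; have [] := dF x.
- apply: cvg_at_right_filter.
  have := dF T; move=> [+ _] => /derivable1_diffP/differentiable_continuous.
  exact.
- by move=> x _; rewrite derive1E; have [_ ->] := dF x.
Qed.

End truncated_powers.

(** * Convergence, positivity and bounds for the Gamma integral *)

Section gamma_function.
Context {R : realType}.
Notation mu := (@lebesgue_measure R).
Implicit Types p t z : R.

(** The bound is uniform in [e], which permits the limit at 0, where the integrand blows up for
    negative [p]. *)
Lemma integral_powR_itvcc p (e : R) : -1 < p -> 0 < e < 1 ->
  (\int[mu]_(t in `[e, 1%R]) (t `^ p)%:E <= ((p + 1)^-1)%:E)%E.
Proof.
move=> p1 /andP[e0 e1].
have p0 : 0 < p + 1 by lra.
have dF (x : R) : 0 < x ->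
    is_derive x (1 : R) (fun t : R => (p + 1)^-1 * t `^ (p + 1)) (x `^ p).
  move=> x0.
  have d1 := @is_deriveZ _ _ _ _ (p + 1)^-1 _ _ _ (is_derive1_powR (p + 1) x0).
  apply: (is_derive_eq d1); rewrite /GRing.scale /= addrK mulrA mulVf ?mul1r//.
  by rewrite gt_eqF.
have cF (x : R) : 0 < x -> {for x, continuous (fun t : R => (p + 1)^-1 * t `^ (p + 1))}.
  by move=> /dF[+ _] => /derivable1_diffP/differentiable_continuous.
rewrite (@continuous_FTC2 _ _ (fun t : R => (p + 1)^-1 * t `^ (p + 1)) e 1 e1).
- rewrite -EFinB lee_fin powR1 mulr1 gerBl mulr_ge0 ?powR_ge0//.
  by rewrite invr_ge0 ltW.
- apply/continuous_within_itvP => //.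
  have cp (x : R) : 0 < x -> {for x, continuous (fun t : R => t `^ p)}.
    by move=> x0; apply/differentiable_continuous/derivable1_diffP;
      apply: derivable_powR; rewrite in_itv /= x0.
  split.
  + by move=> x; rewrite in_itv /= => /andP[ex _]; apply: cp; exact: lt_trans ex.
  + by apply: cvg_at_right_filter; exact: cp.
  + by apply: cvg_at_left_filter; apply: cp.
- split.
  + move=> x; rewrite in_itv /= => /andP[ex _].
    by have [] := dF _ (lt_trans e0 ex).
  + by apply: cvg_at_right_filter; exact: cF.
  + by apply: cvg_at_left_filter; exact: cF.
- move=> x; rewrite in_itv /= => /andP[ex _].
  by rewrite derive1E; have [_ ->] := dF _ (lt_trans e0 ex).
Qed.

Lemma integral_powR_itvoc p : -1 < p ->
  (\int[mu]_(t in `]0%R, 1%R]) (t `^ p)%:E <= ((p + 1)^-1)%:E)%E.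
Proof.
move=> p1.
(* The index [n.+2] keeps the left endpoint strictly below 1. *)
have -> : `]0%R, 1%R]%classic = \bigcup_n `[(n.+2%:R^-1 : R), 1]%classic.
  apply/seteqP; split=> x /=.
    rewrite in_itv /= => /andP[x0 x1].
    have [n nx] : exists n : nat, x^-1 < n.+2%:R.
      exists (Num.truncn x^-1); apply: lt_trans (truncnS_gt _) _.
      by rewrite ltr_nat.
    exists n => //=; rewrite in_itv /= x1 andbT.
    by rewrite invf_ple ?posrE// ltW.
  move=> [n _]; rewrite /= !in_itv /= => /andP[h ->]; rewrite andbT.
  by apply: lt_le_trans h; rewrite invr_gt0.
have cvgF : (\int[mu]_(t in `[(n.+2%:R^-1 : R)%R, 1%R]) (t `^ p)%:E)%E @[n --> \oo]
    --> (\int[mu]_(t in \bigcup_n `[(n.+2%:R^-1 : R)%R, 1%R]%classic) (t `^ p)%:E)%E.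
  apply: ge0_nondecreasing_set_cvg_integral => //.
  - move=> m n mn; apply/subsetPset => x /=; rewrite !in_itv /= => /andP[h ->].
    by rewrite andbT; apply: le_trans h; rewrite lef_pV2 ?posrE// ler_nat.
  - move=> i; apply/measurable_EFinP; apply: measurable_funTS.
    exact: measurable_powR.
  - by move=> i x _; rewrite lee_fin powR_ge0.
rewrite -(cvg_lim (@ereal_hausdorff R) cvgF); apply: lime_le.
  by apply/cvg_ex; eexists; exact: cvgF.
apply: nearW => n; apply: integral_powR_itvcc => //.
by rewrite invr_gt0 ltr0n /= invf_lt1// ltr1n.
Qed.

(** This is ln y <= y at y = t / (2q). The rate 1/2 leaves half of the decay of e^(-t) for
    integrability. *)
Lemma powR_le_expR_half (q t : R) : 0 < q -> 0 < t ->
  t `^ q <= (2 * q) `^ q * expR (2^-1 * t).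
Proof.
move=> q0 t0; rewrite /powR !gt_eqF ?mulr_gt0// -expRD ler_expR.
have -> : ln t = ln (2 * q) + ln (t / (2 * q)).
  rewrite -lnM ?posrE ?mulr_gt0 ?invr_gt0 ?mulr_gt0//.
  by congr ln; field; rewrite gt_eqF.
rewrite mulrDr lerD2l.
have -> : 2^-1 * t = q * (t / (2 * q)) by field; rewrite gt_eqF.
rewrite ler_pM2l//.
by apply/ltW/ln_sublinear; rewrite divr_gt0// mulr_gt0.
Qed.

(** The integrand is dominated by t^p on []0, 1]] and by a multiple of e^(-t/2) beyond 1. *)
Lemma laplace_pospow_lty p : -1 < p -> (laplace 1 (pospow p) < +oo)%E.
Proof.
move=> p1.
(* An exponent above [p] that is also positive, as [powR_le_expR_half] requires. *)
pose q := `|p| + 1.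
have q0 : 0 < q by rewrite /q ltr_wpDl.
have pq : p <= q by rewrite /q (le_trans (ler_norm p))// lerDl.
pose A t := (t `^ p * \1_(`]0%R, 1%R]%classic : set R) t)%:E.
pose B t := (((2 * q) `^ q * expR (- (2^-1 * t))) * \1_(`[0%R, +oo[%classic : set R) t)%:E.
have mA : measurable_fun setT A.
  by apply/measurable_EFinP/measurable_funM; [exact: measurable_powR|exact: measurable_indic].
have mB : measurable_fun setT B.
  apply/measurable_EFinP/measurable_funM; last exact: measurable_indic.
  apply: measurable_funM; first exact: measurable_cst.
  exact: measurable_expRN.
have A0 t : (0 <= A t)%E by rewrite lee_fin mulr_ge0 ?powR_ge0.
have B0 t : (0 <= B t)%E by rewrite lee_fin mulr_ge0 ?mulr_ge0 ?powR_ge0 ?expR_ge0.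
apply: (@le_lt_trans _ _ (\int[mu]_t (A t + B t))%E).
  apply: ge0_le_integral => //.
  - by move=> t _; rewrite lee_fin mulr_ge0 ?expR_ge0 ?pospow_ge0.
  - by apply: measurable_laplace; exact: measurable_pospow.
  - exact: emeasurable_funD.
  - move=> t _; rewrite /A /B -EFinD lee_fin !indicE mul1r.
    have [t0|t0] := leP t 0.
      by rewrite pospow_le0// mulr0 addr_ge0// ?mulr_ge0 ?powR_ge0 ?expR_ge0.
    rewrite pospow_gt0//.
    have -> : (t \in `[0%R, +oo[%classic) = true.
      by apply/mem_set; rewrite /= in_itv /= ltW.
    rewrite mulr1.
    have [t1|t1] := leP t 1.
      have -> : (t \in `]0%R, 1%R]%classic) = true.
        by apply/mem_set; rewrite /= in_itv /= t0.
      rewrite mulr1 ler_wpDr ?mulr_ge0 ?powR_ge0 ?expR_ge0//.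
      by rewrite ler_piMl ?powR_ge0// -expR0 ler_expR oppr_le0 ltW.
    rewrite ler_wpDl ?mulr_ge0 ?powR_ge0//.
    apply: (@le_trans _ _ (expR (- t) * t `^ q)).
      by rewrite ler_wpM2l ?expR_ge0// ler_powR// ltW.
    apply: (@le_trans _ _ (expR (- t) * ((2 * q) `^ q * expR (2^-1 * t)))).
      by rewrite ler_wpM2l ?expR_ge0// powR_le_expR_half.
    rewrite mulrCA -expRD ler_wpM2l ?powR_ge0// ler_expR; lra.
rewrite ge0_integralD//; apply: lte_add_pinfty.
  apply: (@le_lt_trans _ _ ((p + 1)^-1)%:E); last exact: ltry.
  apply: le_trans (integral_powR_itvoc p1).
  rewrite [leRHS]integral_mkcond le_eqVlt; apply/orP; left; apply/eqP.
  apply: eq_integral => x _; rewrite /A patchE indicE.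
  by case: ifPn => _; rewrite ?mulr1 ?mulr0.
have -> : (\int[mu]_x B x = \int[mu]_(x in `[0%R, +oo[) (((2 * q) `^ q)%:E * (expR (- (2^-1 * x)))%:E))%E.
  rewrite [RHS]integral_mkcond.
  apply: eq_integral => x _; rewrite /B patchE indicE.
  by case: ifPn => _; rewrite ?mulr1 ?mulr0// EFinM.
rewrite ge0_integralZl_EFin//.
- by rewrite integral_expRN_itvcy ?ltry// invr_gt0.
- by apply/measurable_EFinP; apply: measurable_funTS; exact: measurable_expRN.
- exact: powR_ge0.
Qed.

Lemma laplace_ge0 (lam : R) (f : R -> R) : (forall t, 0 <= f t) -> (0 <= laplace lam f)%E.
Proof.
by move=> f0; apply: integral_ge0 => x _; rewrite lee_fin mulr_ge0 ?expR_ge0.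
Qed.

Lemma laplace1_pospow z : 0 < z -> laplace 1 (pospow (z - 1)) = (Gamma z)%:E.
Proof.
move=> z0; rewrite GammaE_laplace fineK// ge0_fin_numE.
  by apply: laplace_pospow_lty; lra.
by apply: laplace_ge0 => t; exact: pospow_ge0.
Qed.

(** Write e^(-T) as the integral of e^(-u) over u > T; there T^p <= u^p. This gives the
    factorial-type decay behind the Neumann series. *)
Lemma powR_expRN_le_Gamma p T : 0 <= p -> 0 <= T ->
  T `^ p * expR (- T) <= Gamma (p + 1).
Proof.
move=> p0 T0; rewrite -lee_fin -laplace1_pospow ?addrK; last lra.
have -> : (T `^ p * expR (- T))%:E =
    ((T `^ p)%:E * \int[mu]_(u in `]T, +oo[) (expR (- (1 * u)))%:E)%E.
  rewrite integral_itv_obnd_cbnd; last first.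
    apply/measurable_EFinP; apply: measurable_funTS; exact: measurable_expRN.
  by rewrite integral_expRN_itvcy// invr1 !mul1r EFinM.
rewrite -ge0_integralZl_EFin//.
- rewrite integral_mkcond /laplace; apply: ge0_le_integral => //.
  + move=> x _; rewrite patchE; case: ifP => // _.
    by rewrite -EFinM lee_fin mulr_ge0 ?powR_ge0 ?expR_ge0.
  + apply/(measurable_restrictT _ _).1 => //; apply/measurable_EFinP.
    apply: measurable_funTS; apply: measurable_funM; first exact: measurable_cst.
    exact: measurable_expRN.
  + by apply: measurable_laplace; exact: measurable_pospow.
  + move=> x _; rewrite patchE; case: ifPn; last first.
      by move=> _; rewrite lee_fin mulr_ge0 ?expR_ge0 ?pospow_ge0.
    rewrite inE /= in_itv /= andbT => Tx.
    rewrite -EFinM lee_fin mulrC ler_wpM2l ?expR_ge0//.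
    have x0 := le_lt_trans T0 Tx.
    by rewrite pospow_gt0//; apply: ge0_ler_powR; rewrite ?nnegrE// ltW.
- by apply/measurable_EFinP; apply: measurable_funTS; exact: measurable_expRN.
- exact: powR_ge0.
Qed.

(** For z >= 1 use the previous bound at T = 1; for z < 1 the integrand is at least e^(-1) on []0,
    1[], the exponent [z - 1] being negative. *)
Lemma Gamma_gt0 z : 0 < z -> 0 < Gamma z.
Proof.
move=> z0; have [z1|z1] := leP 1 z.
  have := @powR_expRN_le_Gamma (z - 1) 1; rewrite subrK => /(_ _ _)/lt_le_trans.
  by apply; rewrite ?subr_ge0// powR1 mul1r expR_gt0.
rewrite -lte_fin -laplace1_pospow//.
apply: (@lt_le_trans _ _ (\int[mu]_(x in `]0%R, 1%R[) (expR (- 1))%:E)%E).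
  by rewrite integral_cst//= lebesgue_measure_itv /= lte_fin ltr01 oppr0 adde0 mule1
     lte_fin expR_gt0.
rewrite integral_mkcond /laplace; apply: ge0_le_integral => //.
- by move=> x _; rewrite patchE; case: ifP => // _; rewrite lee_fin expR_ge0.
- by apply/(measurable_restrictT _ _).1.
- by apply: measurable_laplace; exact: measurable_pospow.
- move=> x _; rewrite patchE; case: ifPn; last first.
    by move=> _; rewrite lee_fin mulr_ge0 ?expR_ge0 ?pospow_ge0.
  rewrite inE /= in_itv /= => /andP[x0 x1].
  rewrite lee_fin pospow_gt0// mul1r -[leLHS]mulr1 ler_pM ?expR_ge0//.
    by rewrite ler_expR lerN2 ltW.
  rewrite -[leLHS](powRr0 x); apply: ger_powR; first by rewrite x0 ltW.
  by rewrite subr_le0 ltW.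
Qed.

Lemma Gamma1 : Gamma 1 = 1 :> R.
Proof.
rewrite GammaE_laplace subrr /laplace.
have -> : (\int[mu]_t (expR (- (1 * t)) * pospow 0 t)%:E =
    \int[mu]_(t in `]0%R, +oo[) (expR (- (1 * t)))%:E)%E.
  rewrite [RHS]integral_mkcond; apply: eq_integral => t _; rewrite patchE.
  case: ifPn; rewrite ?inE ?notin_setE /= in_itv /= andbT.
    by move=> t0; rewrite pospow_gt0// powRr0 mulr1.
  by move=> /negP; rewrite -leNgt => t0; rewrite pospow_le0// mulr0.
rewrite integral_itv_obnd_cbnd; last first.
  apply/measurable_EFinP; apply: measurable_funTS; exact: measurable_expRN.
by rewrite integral_expRN_itvcy//= invr1 mulr0 oppr0 expR0 mulr1.
Qed.

End gamma_function.

(** * Convolution with power kernels and the Beta-Gamma identity *)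

Section convolution.
Context {R : realType}.
Notation mu := (@lebesgue_measure R).
Implicit Types (p q t s m : R) (f : R -> R).

Lemma ge0_integral_shift (u : R) (F : R -> \bar R) :
  measurable_fun setT F -> (forall x, (0 <= F x)%E) ->
  (\int[mu]_x F (x - u)%R = \int[mu]_x F x)%E.
Proof.
move=> mF F0; rewrite [RHS](@ge0_integral_affine _ 1 (- u))// mul1e.
by apply: eq_integral => x _; rewrite mul1r.
Qed.

Lemma measurable_shift_fun f (u : R) : measurable_fun setT f ->
  measurable_fun setT (fun x : R => f (x - u)).
Proof.
move=> mf; apply: (measurableT_comp mf).
by apply: measurable_funB; [exact: measurable_id|exact: measurable_cst].
Qed.

Lemma measurable_conv_kernel p t f : measurable_fun setT f ->
  measurable_fun setT (fun s : R => pospow p (t - s) * f s).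
Proof.
move=> mf; apply: measurable_funM mf; apply: measurable_pospow_comp.
by apply: measurable_funB; [exact: measurable_cst|exact: measurable_id].
Qed.

Lemma measurable_laplace_kernel (lam p : R) f : measurable_fun setT f ->
  measurable_fun [set: R * R] (fun z : R * R =>
    expR (- (lam * z.1)) * (pospow p (z.1 - z.2) * f z.2)).
Proof.
move=> mf; apply: measurable_funM.
  exact: (measurableT_comp (measurable_expRN lam) measurable_fst).
apply: measurable_funM.
  by apply: measurable_pospow_comp; apply: measurable_funB;
    [exact: measurable_fst|exact: measurable_snd].
exact: (measurableT_comp mf measurable_snd).
Qed.

Lemma integral_laplace_kernel (lam p s : R) :
  (\int[mu]_t (expR (- (lam * t)) * pospow p (t - s))%:E =
   (expR (- (lam * s)))%:E * laplace lam (pospow p))%E.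
Proof.
rewrite /laplace -[in RHS](@ge0_integral_shift s); last 2 first.
- by apply: measurable_laplace; exact: measurable_pospow.
- by move=> x; rewrite lee_fin mulr_ge0 ?expR_ge0 ?pospow_ge0.
rewrite -ge0_integralZl_EFin ?expR_ge0//.
- apply: eq_integral => t _; rewrite -EFinM mulrA -expRD.
  by congr (expR _ * _)%:E; ring.
- by move=> t _; rewrite lee_fin mulr_ge0 ?expR_ge0 ?pospow_ge0.
- apply/measurable_EFinP.
  apply: (@measurable_shift_fun (fun t => expR (- (lam * t)) * pospow p t)).
  by apply: measurable_funM; [exact: measurable_expRN|exact: measurable_pospow].
Qed.

(** Tonelli exchanges the integrals, and the inner one is a translated transform of the kernel. *)
Lemma laplace_conv (lam p : R) f :
  measurable_fun setT f -> (forall s, 0 <= f s) ->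
  (\int[mu]_t \int[mu]_s
     (expR (- (lam * t)) * (pospow p (t - s) * f s))%:E =
   laplace lam (pospow p) * laplace lam f)%E.
Proof.
move=> mf f0.
pose K (z : R * R) := (expR (- (lam * z.1)) * (pospow p (z.1 - z.2) * f z.2))%:E.
have mK : measurable_fun setT K.
  by apply/measurable_EFinP; exact: measurable_laplace_kernel.
have K0 z : (0 <= K z)%E.
  by rewrite lee_fin !mulr_ge0 ?expR_ge0 ?pospow_ge0.
rewrite (@fubini_tonelli _ _ _ _ _ mu mu K)//.
rewrite -ge0_integralZl//; last 3 first.
- by apply: measurable_laplace.
- by move=> x _; rewrite lee_fin mulr_ge0 ?expR_ge0.
- by apply: laplace_ge0 => x; exact: pospow_ge0.
apply: eq_integral => s _; rewrite /K /=.
under eq_integral do rewrite mulrA EFinM muleC.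
rewrite ge0_integralZl_EFin//.
- rewrite integral_laplace_kernel muleA -EFinM muleC; congr (_ * _)%E.
  by rewrite mulrC.
- by move=> x _; rewrite lee_fin mulr_ge0 ?expR_ge0 ?pospow_ge0.
- apply/measurable_EFinP; apply: measurable_funM; first exact: measurable_expRN.
  exact: (@measurable_shift_fun (pospow p) s (measurable_pospow p)).
Qed.

(** By homogeneity the convolution at x is C x_+^(p+q-1), with C its value at 1. Taking Laplace
    transforms at 1 gives C Gamma(p+q) = Gamma(q) Gamma(p), which determines C without computing a
    Beta integral. *)
Lemma conv_pospow p q t : 0 < p -> 0 < q ->
  (\int[mu]_s (pospow (q - 1) (t - s) * pospow (p - 1) s)%:E =
   (Gamma q * Gamma p / Gamma (p + q) * pospow (p + q - 1) t)%:E)%E.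
Proof.
move=> p0 q0.
have pq0 : 0 < p + q by exact: addr_gt0.
pose F t s := (pospow (q - 1) (t - s) * pospow (p - 1) s)%:E.
have mF x : measurable_fun setT (F x).
  by apply/measurable_EFinP; apply: measurable_conv_kernel; exact: measurable_pospow.
have F0 x s : (0 <= F x s)%E by rewrite lee_fin mulr_ge0 ?pospow_ge0.
pose C := (\int[mu]_s F 1%R s)%E.
have C0 : (0 <= C)%E by apply: integral_ge0.
have convE x : (\int[mu]_s F x s = (pospow (p + q - 1) x)%:E * C)%E.
  have [x0|x0] := leP x 0.
    rewrite pospow_le0// mul0e; apply: integral0_eq => s _; rewrite /F.
    have [s0|s0] := leP s 0; first by rewrite (pospow_le0 _ s0) mulr0.
    by rewrite pospow_le0 ?mul0r// subr_le0 (le_trans x0)// ltW.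
  rewrite (ge0_integral_affine 0 x0 (mF x) (F0 x)) /C.
  have mF1 := mF 1; have F01 := F0 1.
  have mFx : measurable_fun setT (fun s => F x (x * s + 0)).
    by apply: (measurableT_comp (mF x)); exact: measurable_affine.
  have F0x s : (0 <= F x (x * s + 0)%R)%E by [].
  transitivity (\int[mu]_s (x%:E * F x (x * s + 0)%R))%E.
    by rewrite ge0_integralZl_EFin// ltW.
  transitivity (\int[mu]_s ((pospow (p + q - 1) x)%:E * F 1%R s))%E; last first.
    by rewrite ge0_integralZl_EFin ?pospow_ge0.
  apply: eq_integral => s _; rewrite /F -!EFinM addr0; congr EFin.
  have -> : x - x * s = x * (1 - s) by ring.
  rewrite (pospowZ _ (1 - s) x0) (pospowZ _ s x0) (pospow_gt0 _ x0).
  have -> : x `^ (p + q - 1) = x * (x `^ (q - 1) * x `^ (p - 1)).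
    have H u v : x `^ (u + v) = x `^ u * x `^ v.
      by apply: powRD; rewrite (gt_eqF x0) implybT.
    by rewrite -H -{2}[x]powRr1 ?(ltW x0)// -H; congr (_ `^ _); ring.
  ring.
have := @laplace_conv 1 (q - 1) (pospow (p - 1)) (measurable_pospow _)
  (fun s => pospow_ge0 _ _).
rewrite !laplace1_pospow//.
have E x : (\int[mu]_s (expR (- (1 * x)) *
      (pospow (q - 1) (x - s) * pospow (p - 1) s))%:E =
    C * (expR (- (1 * x)) * pospow (p + q - 1) x)%:E)%E.
  transitivity (\int[mu]_s ((expR (- (1 * x)))%:E * F x s))%E.
    by apply: eq_integral => s _; rewrite -EFinM.
  rewrite ge0_integralZl_EFin ?expR_ge0//; last exact: mF.
  by rewrite convE muleA -EFinM muleC.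
under eq_integral do rewrite E.
rewrite ge0_integralZl//; last 2 first.
- by apply: measurable_laplace; exact: measurable_pospow.
- by move=> x _; rewrite lee_fin mulr_ge0 ?expR_ge0 ?pospow_ge0.
rewrite -/(laplace 1 _) laplace1_pospow// => CE.
rewrite convE.
have G0 := Gamma_gt0 pq0.
(* [C] is so far an extended real; [+oo] is excluded because its product with [Gamma (p + q)] is
   finite. *)
clearbody C; clear convE E; case: C CE C0 => [c| |] //; last first.
  by rewrite gt0_mulye ?lte_fin//.
rewrite -!EFinM => -[cE] _; rewrite -cE; congr EFin; field.
by rewrite gt_eqF.
Qed.

(** The Beta-Gamma identity at p = q = t = 1, where the convolution is the length of []0, 1[]. *)
Lemma Gamma2 : Gamma (1 + 1) = 1 :> R.
Proof.
have := @conv_pospow 1 1 1 ltr01 ltr01.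
rewrite Gamma1 !mul1r pospow_gt0// powR1 mulr1 subrr.
have -> : (\int[mu]_s (pospow 0 (1 - s) * pospow 0 s)%:E =
    \int[mu]_(s in `]0%R, 1%R[) (cst 1 s))%E.
  rewrite [RHS]integral_mkcond; apply: eq_integral => s _; rewrite patchE.
  case: ifPn; rewrite ?inE ?notin_setE /= in_itv /=.
    move=> /andP[s0 s1].
    by rewrite !pospow_gt0 ?subr_gt0// !powRr0 mulr1.
  move=> /negP; rewrite negb_and -!leNgt => /orP[s0|s1].
    by rewrite (pospow_le0 _ s0) mulr0.
  by rewrite pospow_le0 ?mul0r// subr_le0.
rewrite integral_cst//= lebesgue_measure_itv /= lte_fin ltr01 oppr0 adde0 mule1.
by case=> e; rewrite -[LHS]invrK -e invr1.
Qed.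

End convolution.

(** * Fractional integrals of normalized truncated powers *)

Section fractional_integral.
Context {R : realType}.
Notation mu := (@lebesgue_measure R).
Implicit Types (p q t s m v w : R) (f : R -> R).

(* [v / Gamma m] is the Riemann-Liouville integral of order [m] of [f] at [t]
   (the base point is 0 for the [f] of interest, which vanish on t <= 0). *)
Definition is_conv m t f v : Prop :=
  mu.-integrable setT (fun s => (pospow (m - 1) (t - s) * f s)%:E) /\
  (\int[mu]_s (pospow (m - 1) (t - s) * f s)%:E = v%:E)%E.

Lemma is_convD m t f1 f2 v1 v2 : is_conv m t f1 v1 -> is_conv m t f2 v2 ->
  is_conv m t (fun s => f1 s + f2 s) (v1 + v2).
Proof.
move=> [i1 e1] [i2 e2]; rewrite /is_conv.
have -> : (fun s => (pospow (m - 1) (t - s) * (f1 s + f2 s))%:E) =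
  (fun s => (pospow (m - 1) (t - s) * f1 s)%:E) \+
  (fun s => (pospow (m - 1) (t - s) * f2 s)%:E).
  by apply/funext => s /=; rewrite mulrDr EFinD.
by split; [exact: integrableD|rewrite integralD// e1 e2].
Qed.

Lemma is_convZ m t f v k : is_conv m t f v ->
  is_conv m t (fun s => k * f s) (k * v).
Proof.
move=> [i e]; rewrite /is_conv.
have -> : (fun s => (pospow (m - 1) (t - s) * (k * f s))%:E) =
  (fun s => k%:E * (pospow (m - 1) (t - s) * f s)%:E)%E.
  by apply/funext => s /=; rewrite -EFinM mulrCA.
by split; [exact: integrableZl|rewrite integralZl// e].
Qed.

(** The normalization absorbs the Gamma quotient of the Beta-Gamma identity: fractional integration
    of order m just adds m to [p]. *)
Definition fracpow p t := pospow p t / Gamma (p + 1).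

Lemma measurable_fracpow p : measurable_fun [set: R] (fracpow p).
Proof. by apply: measurable_funM; [exact: measurable_pospow|exact: measurable_cst]. Qed.

Lemma fracpow_le0 p t : t <= 0 -> fracpow p t = 0.
Proof. by move=> t0; rewrite /fracpow pospow_le0// mul0r. Qed.

Lemma fracpow_ge0 p t : -1 < p -> 0 <= fracpow p t.
Proof.
move=> p1; apply: mulr_ge0; first exact: pospow_ge0.
by rewrite invr_ge0 ltW// Gamma_gt0//; lra.
Qed.

(** The Beta-Gamma identity translated by [u]; integrability follows because the integrand is
    nonnegative with finite integral. *)
Lemma is_conv_fracpow m t p u : 0 < m -> -1 < p ->
  is_conv m t (fun s => fracpow p (s - u)) (Gamma m * fracpow (p + m) (t - u)).
Proof.
move=> m0 p1; have p0 : 0 < p + 1 by lra.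
have -> : (fun s => fracpow p (s - u)) =
   (fun s => (Gamma (p + 1))^-1 * pospow p (s - u)).
  by apply/funext => s; rewrite mulrC.
have -> : Gamma m * fracpow (p + m) (t - u) = (Gamma (p + 1))^-1 *
   (Gamma m * Gamma (p + 1) / Gamma (p + 1 + m) * pospow (p + 1 + m - 1) (t - u)).
  rewrite /fracpow; have -> : p + 1 + m - 1 = p + m by ring.
  have -> : p + m + 1 = p + 1 + m by ring.
  have := Gamma_gt0 p0; have := Gamma_gt0 (addr_gt0 p0 m0).
  move: (Gamma m) (Gamma (p + 1)) (Gamma (p + 1 + m)) (pospow _ _).
  by move=> g1 g2 g3 x h3 h2; field; rewrite (gt_eqF h2) (gt_eqF h3).
apply: is_convZ.
have mf : measurable_fun setT
    (fun s => (pospow (m - 1) (t - s) * pospow p (s - u))%:E).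
  apply/measurable_EFinP.
  apply: (@measurable_conv_kernel _ _ _ (fun s => pospow p (s - u))).
  exact: (measurable_shift_fun u (measurable_pospow p)).
have e : (\int[mu]_s (pospow (m - 1) (t - s) * pospow p (s - u))%:E =
    (Gamma m * Gamma (p + 1) / Gamma (p + 1 + m) *
     pospow (p + 1 + m - 1) (t - u))%:E)%E.
  pose F s := (pospow (m - 1) (t - u - s) * pospow (p + 1 - 1) s)%:E.
  have mF : measurable_fun setT F.
    by apply/measurable_EFinP; apply: measurable_conv_kernel; exact: measurable_pospow.
  have F0 s : (0 <= F s)%E by rewrite lee_fin mulr_ge0 ?pospow_ge0.
  rewrite -(conv_pospow (t - u) p0 m0).
  transitivity (\int[mu]_s F (s - u)%R)%E; last exact: ge0_integral_shift.
  apply: eq_integral => s _; rewrite /F addrK.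
  by congr (pospow _ _ * _)%:E; ring.
split=> //; apply/integrableP; split=> //.
under eq_integral do rewrite abse_EFin ger0_norm ?mulr_ge0 ?pospow_ge0//.
by rewrite e ltry.
Qed.

(** Use [powR_expRN_le_Gamma] at T = k t. The gain k^(-p) is what makes a Picard step contract once
    [k] is large. *)
Lemma fracpow_le_expR (k p t : R) : 0 < k -> 0 <= p ->
  fracpow p t <= expR (k * t) * k `^ (- p).
Proof.
move=> k0 p0.
have [t0|t0] := leP t 0.
  by rewrite fracpow_le0// mulr_ge0 ?powR_ge0 ?expR_ge0.
rewrite /fracpow pospow_gt0//.
have G0 : 0 < Gamma (p + 1) :> R by apply: Gamma_gt0; lra.
have kt0 : 0 <= k * t by rewrite mulr_ge0 ?ltW.
rewrite ler_pdivrMr//.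
have E0 := expR_gt0 (k * t); have K0 := powR_gt0 p k0.
have -> : t `^ p = expR (k * t) * k `^ (- p) * ((k * t) `^ p * expR (- (k * t))).
  rewrite powRM ?(ltW k0) ?(ltW t0)// powRN expRN.
  by field; rewrite (gt_eqF E0) (gt_eqF K0).
by rewrite ler_wpM2l ?mulr_ge0 ?powR_ge0 ?expR_ge0// powR_expRN_le_Gamma.
Qed.

Lemma fracpow0 t : 0 < t -> fracpow 0 t = 1.
Proof. by move=> t0; rewrite /fracpow pospow_gt0// powRr0 add0r Gamma1 divr1. Qed.

Lemma continuous_fracpow_gt0 p t : 0 < t -> {for t, continuous (fracpow p)}.
Proof.
move=> t0; rewrite /fracpow /continuous_at; apply: cvgMr_tmp.
have : {for t, continuous (fun t : R => t `^ p)}.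
  by apply/differentiable_continuous/derivable1_diffP;
    apply: derivable_powR; rewrite in_itv /= t0.
move=> h; rewrite pospow_gt0//; apply: cvg_trans h.
apply: near_eq_cvg; near=> x; rewrite pospow_gt0//.
by near: x; exact: lt_nbhsr.
Unshelve. all: by end_near. Qed.

Lemma continuous_fracpow p : 0 < p -> continuous (fracpow p).
Proof.
move=> p0 t; have [t0|t0] := ltP 0 t; first exact: continuous_fracpow_gt0.
rewrite le_eqVlt in t0; case/predU1P: t0 => [->|t0]; last first.
  rewrite /continuous_at fracpow_le0; last exact: ltW.
  apply: cvg_near_cst; near=> x; rewrite fracpow_le0//.
  by apply: ltW; near: x; exact: lt_nbhsl.
rewrite /continuous_at fracpow_le0//.
suff h : pospow p x @[x --> (0 : R)] --> (0 : R).
  by have := cvgMr_tmp (b := (Gamma (p + 1))^-1) h; rewrite mul0r; exact.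
(* The radius e^(1/p) works, since x^p is monotone. *)
apply/cvgrPdist_le => e e0.
apply: filterS (@nbhs0_le R R _ (powR_gt0 p^-1 e0)) => x xe.
rewrite sub0r normrN ger0_norm ?pospow_ge0//.
have [x0|x0] := leP x 0; first by rewrite pospow_le0// ltW.
rewrite pospow_gt0//.
have -> : e = (e `^ p^-1) `^ p.
  by rewrite -powRrM mulVf ?gt_eqF// powRr1// ltW.
apply: ge0_ler_powR; rewrite ?nnegrE ?powR_ge0// ?(ltW p0) ?(ltW x0)//.
exact: le_trans (ler_norm _) xe.
Unshelve. all: by end_near. Qed.

End fractional_integral.

(** * Explicit bounds for series dominated by a geometric series of ratio 1/2 *)

Section half_geometric_series.
Context {R : realType}.
Variables (u : R^nat) (M : R).
Hypothesis uM : forall n, `|u n| <= M * 2^-1 ^+ n.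

Let M0 : 0 <= M.
Proof. by have := uM 0; rewrite expr0 mulr1; apply: le_trans; exact: normr_ge0. Qed.

Lemma is_cvg_half_geometric : cvgn (series u).
Proof.
apply: normed_cvg; apply: (@series_le_cvg _ _ (geometric M 2^-1)).
- by move=> n; exact: normr_ge0.
- by move=> n; rewrite /geometric /= mulr_ge0// exprn_ge0// invr_ge0.
- exact: uM.
- by apply: is_cvg_geometric_series; rewrite ger0_norm// invf_lt1// ltr1n.
Qed.

(** The right side is the exact sum of the majorizing terms, so the induction closes with an
    equality. *)
Lemma half_geometric_sub N n :
  `|series u (N + n)%N - series u N| <= 2 * M * (2^-1 ^+ N - 2^-1 ^+ (N + n)).
Proof.
elim: n => [|n IH].
  by rewrite addn0 !subrr normr0 mulr0.
rewrite addnS seriesSr.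
have -> : series u (N + n)%N + u (N + n)%N - series u N =
  (series u (N + n)%N - series u N) + u (N + n)%N by ring.
apply: le_trans (ler_normD _ _) _; apply: le_trans (lerD IH (uM _)) _.
rewrite le_eqVlt; apply/orP; left; apply/eqP.
by rewrite exprS; field.
Qed.

Lemma half_geometric_norm N : `|series u N| <= 2 * M.
Proof.
have := half_geometric_sub 0 N; rewrite add0n.
rewrite (_ : series u 0 = 0) ?subr0; last by rewrite /series /= big_geq.
move/le_trans; apply.
rewrite -[leRHS]mulr1 ler_wpM2l ?mulr_ge0// expr0 gerBl exprn_ge0// invr_ge0//.
Qed.

Lemma half_geometric_tail N :
  `|limn (series u) - series u N| <= 2 * M * 2^-1 ^+ N.
Proof.
apply/ler_addgt0Pl => e e0.
have /cvgrPdist_le /(_ e e0) [K _ HK] := is_cvg_half_geometric.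
have {}HK := HK (N + K)%N (leq_addl _ _).
have -> : limn (series u) - series u N = (limn (series u) - series u (N + K)%N) +
  (series u (N + K)%N - series u N) by ring.
apply: le_trans (ler_normD _ _) _; apply: lerD; first exact: HK.
apply: le_trans (half_geometric_sub _ _) _.
by rewrite ler_wpM2l ?mulr_ge0// gerBl exprn_ge0// invr_ge0.
Qed.

End half_geometric_series.

(** * The Neumann series of the delayed Volterra equation *)

Section fractional_delay_series.
Context {R : realType}.
Notation mu := (@lebesgue_measure R).
Variables (alpha A B C tau k : R).
Hypotheses (alpha0 : 0 < alpha) (tau0 : 0 <= tau) (k0 : 0 < k).
(* [k] is the rate of an exponential weight [expR (k * t)] for which one Picard
   step is a contraction of factor 1/2. *)
Hypothesis small : (`|A| + `|B|) * k `^ (- (2 * alpha)) + `|C| * k `^ (- alpha) <= 2^-1.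
Implicit Types (p s t m : R) (n : nat).

(* With [I] the fractional integral, [picard n p s] is the n-th power of the
   operator [A I^(2 alpha) + B I^(2 alpha) (. - tau) + C I^alpha] applied to
   [fracpow p (. - s)]; integrating raises [p] and delaying raises [s]. *)
Fixpoint picard n p s t : R :=
  if n is n'.+1 then
    A * picard n' (p + 2 * alpha) s t + B * picard n' (p + 2 * alpha) (s + tau) t
    + C * picard n' (p + alpha) s t
  else fracpow p (t - s).

(** The Picard operator commutes with translations; hence the series started at [tau] is the delayed
    solution. *)
Lemma picard_shift n p s u t : picard n p (s + u) t = picard n p s (t - u).
Proof.
elim: n p s => [|n IH] p s /=; first by congr fracpow; ring.
by rewrite (addrAC s u tau) !IH.
Qed.

Lemma picard_le n p s t : t <= s -> picard n p s t = 0.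
Proof.
elim: n p s => [|n IH] p s ts /=; first by rewrite fracpow_le0// subr_le0.
by rewrite !IH ?mulr0 ?addr0// (le_trans ts)// lerDl.
Qed.

(** Raising the exponent by 2 alpha or alpha gains the matching power of 1/k, and a delay does not
    worsen the bound; [small] makes the total gain at most 1/2 per step. *)
Lemma picard_bound n p s t : 0 <= p -> 0 <= s ->
  `|picard n p s t| <= expR (k * t) * k `^ (- p) * 2^-1 ^+ n.
Proof.
elim: n p s => [|n IH] p s p0 s0 /=.
  rewrite expr0 mulr1 ger0_norm; last by apply: fracpow_ge0; lra.
  apply: le_trans (fracpow_le_expR _ k0 p0) _.
  by rewrite ler_wpM2r ?powR_ge0// ler_expR ler_wpM2l ?(ltW k0)// gerBl.
have a0 := alpha0.
have pa : 0 <= p + alpha by lra.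
have p2a : 0 <= p + 2 * alpha by lra.
have st : 0 <= s + tau by exact: addr_ge0.
have H1 := IH _ _ p2a s0; have H2 := IH _ _ p2a st; have H3 := IH _ _ pa s0.
have Ek q : k `^ (- (p + q)) = k `^ (- p) * k `^ (- q).
  by rewrite opprD powRD// (gt_eqF k0) implybT.
rewrite !Ek in H1 H2 H3.
set E := expR (k * t) * k `^ (- p) * 2^-1 ^+ n.
have E0 : 0 <= E by rewrite !mulr_ge0 ?expR_ge0 ?powR_ge0 ?exprn_ge0 ?invr_ge0.
apply: (@le_trans _ _ (((`|A| + `|B|) * k `^ (- (2 * alpha)) + `|C| * k `^ (- alpha)) * E)).
  apply: le_trans (ler_normD _ _) _; apply: le_trans (lerD (ler_normD _ _) (lexx _)) _.
  set x1 := picard _ _ _ _ in H1 *; set x2 := picard _ _ _ _ in H2 *.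
  set x3 := picard _ _ _ _ in H3 *; rewrite !normrM.
  apply: le_trans (lerD (lerD (ler_wpM2l (normr_ge0 A) H1)
    (ler_wpM2l (normr_ge0 B) H2)) (ler_wpM2l (normr_ge0 C) H3)) _.
  by rewrite /E le_eqVlt; apply/orP; left; apply/eqP; ring.
apply: le_trans (ler_wpM2r E0 small) _.
by rewrite /E exprS le_eqVlt; apply/orP; left; apply/eqP; ring.
Qed.

(** Fractional integration commutes with the Picard operator, so only the base case needs the
    Beta-Gamma identity. *)
Lemma is_conv_picard n m p s t : 0 < m -> -1 < p ->
  is_conv m t (picard n p s) (Gamma m * picard n (p + m) s t).
Proof.
move=> m0; elim: n p s => [|n IH] p s p1; first exact: is_conv_fracpow.
have -> : Gamma m * picard n.+1 (p + m) s t =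
    A * (Gamma m * picard n (p + 2 * alpha + m) s t) +
    B * (Gamma m * picard n (p + 2 * alpha + m) (s + tau) t) +
    C * (Gamma m * picard n (p + alpha + m) s t).
  rewrite /= !(addrAC p _ m).
  move: (Gamma m) (picard _ _ _ _) (picard _ _ _ _) (picard _ _ _ _) => g x y z.
  ring.
have a0 := alpha0.
by apply: is_convD; first apply: is_convD; apply: is_convZ; apply: IH; lra.
Qed.

Lemma continuous_picard n p s : 0 < p -> continuous (picard n p s).
Proof.
elim: n p s => [|n IH] p s p0 t /=.
  apply: (@continuous_comp _ _ _ (fun t : R => t - s) (fracpow p));
    last exact: continuous_fracpow.
  by apply: cvgB; [exact: cvg_id|exact: cvg_cst].
have a0 := alpha0.
by apply: cvgD; first apply: cvgD; apply: cvgMl_tmp; apply: IH; lra.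
Qed.

Lemma measurable_picard n p s : measurable_fun setT (picard n p s).
Proof.
elim: n p s => [|n IH] p s /=.
  exact: (@measurable_shift_fun _ (fracpow p) s (measurable_fracpow p)).
apply: measurable_funD; first apply: measurable_funD;
  by apply: measurable_funM; [exact: measurable_cst|exact: IH].
Qed.

(** The solution of the Volterra equation with forcing term [fracpow p (t - s)]. The limit is
    meaningful by [picard_sum_cvg] for nonnegative [p] and [s]; the proof of [picard_sumE] extends
    this to p >= - alpha. *)
Definition picard_sum p s t : R := limn (series (fun n => picard n p s t)).

Lemma picard_sum_cvg p s t : 0 <= p -> 0 <= s ->
  cvgn (series (fun n => picard n p s t)).
Proof.
move=> p0 s0.
exact: (@is_cvg_half_geometric _ _ _ (fun n => picard_bound n t p0 s0)).
Qed.

Lemma picard_sum_shift p s u t : picard_sum p (s + u) t = picard_sum p s (t - u).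
Proof.
rewrite /picard_sum; have -> // : (fun n => picard n p (s + u) t) =
  (fun n => picard n p s (t - u)).
by apply/funext => n; exact: picard_shift.
Qed.

Lemma picard_sum_le p s t : t <= s -> picard_sum p s t = 0.
Proof.
move=> ts; rewrite /picard_sum (_ : series _ = cst 0) ?lim_cst//.
by apply/funext => n; rewrite /series /= big1// => i _; rewrite picard_le.
Qed.

Lemma picard_sum_bound p s t : 0 <= p -> 0 <= s ->
  `|picard_sum p s t| <= 2 * (expR (k * t) * k `^ (- p)).
Proof.
move=> p0 s0.
have := half_geometric_tail (fun n => picard_bound n t p0 s0) 0.
rewrite (_ : series _ 0 = 0) ?subr0 ?expr0 ?mulr1//.
by rewrite /series /= big_geq.
Qed.

(** Splitting off the first term yields the Volterra equation. The remaining series have exponents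
    at least [p + alpha], so they converge even for some negative [p]. *)
Lemma picard_sumE p s t : 0 <= p + alpha -> 0 <= s ->
  picard_sum p s t = fracpow p (t - s) + A * picard_sum (p + 2 * alpha) s t +
    B * picard_sum (p + 2 * alpha) (s + tau) t + C * picard_sum (p + alpha) s t.
Proof.
move=> pa s0; apply: cvg_lim => //; rewrite -cvg_shiftS /=.
have -> : (fun n => series (fun n => picard n p s t) n.+1) = (fun n =>
    fracpow p (t - s) + A * series (fun n => picard n (p + 2 * alpha) s t) n +
    B * series (fun n => picard n (p + 2 * alpha) (s + tau) t) n +
    C * series (fun n => picard n (p + alpha) s t) n).
  apply/funext => n; rewrite /series /= big_nat_recl// /=.
  by rewrite big_split big_split /= -!mulr_sumr !addrA.
have a0 := alpha0.
have p2a : 0 <= p + 2 * alpha by lra.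
apply: cvgD; first apply: cvgD; first apply: cvgD; first exact: cvg_cst;
  apply: cvgMl_tmp; apply: picard_sum_cvg => //; exact: addr_ge0.
Qed.

End fractional_delay_series.

(** * Measurability, fractional integration and continuity of the series *)

Section fractional_delay_series_calculus.
Context {R : realType}.
Notation mu := (@lebesgue_measure R).
Variables (alpha A B C tau k : R).
Hypotheses (alpha0 : 0 < alpha) (tau0 : 0 <= tau) (k0 : 0 < k).
Hypothesis small : (`|A| + `|B|) * k `^ (- (2 * alpha)) + `|C| * k `^ (- alpha) <= 2^-1.
Implicit Types (p s t m : R) (n : nat).

Local Notation X := (picard alpha A B C tau).
Local Notation Y := (picard_sum alpha A B C tau).
Local Notation bound := (picard_bound alpha0 tau0 k0 small).

Lemma measurable_picard_series p s n :
  measurable_fun setT (fun t => series (fun i => X i p s t) n).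
Proof.
rewrite /series /=; apply: measurable_sum => i; exact: measurable_picard.
Qed.

Lemma measurable_picard_sum p s : 0 <= p -> 0 <= s -> measurable_fun setT (Y p s).
Proof.
move=> p0 s0; apply: (@measurable_fun_cvg _ _ _ _
  (fun n t => series (fun i => X i p s t) n)).
  by move=> n; exact: measurable_picard_series.
move=> t _; exact: (picard_sum_cvg alpha0 tau0 k0 small).
Qed.

Lemma is_conv_picard_series m p s t n : 0 < m -> -1 < p ->
  is_conv m t (fun x => series (fun i => X i p s x) n)
    (Gamma m * series (fun i => X i (p + m) s t) n).
Proof.
move=> m0 p1; elim: n => [|n IH].
  (* The empty sum is written as 0 times a term so that [is_convZ] covers it. *)
  have -> : (fun x => series (fun i => X i p s x) 0) = (fun x => 0 * X 0 p s x).
    by apply/funext => x; rewrite /series /= big_geq// mul0r.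
  have -> : Gamma m * series (fun i => X i (p + m) s t) 0 =
    0 * (Gamma m * X 0 (p + m) s t) by rewrite /series /= big_geq// mulr0 mul0r.
  by apply: is_convZ; exact: is_conv_picard.
have -> : (fun x => series (fun i => X i p s x) n.+1) =
    (fun x => series (fun i => X i p s x) n + X n p s x).
  by apply/funext => x; rewrite seriesSr.
by rewrite seriesSr mulrDr; apply: is_convD => //; exact: is_conv_picard.
Qed.

(* The restriction [0 <= p] makes the partial sums uniformly bounded on bounded
   intervals, so that convergence is dominated. *)
Lemma is_conv_picard_sum m p s t : 0 < m -> 0 <= p -> 0 <= s ->
  is_conv m t (Y p s) (Gamma m * Y (p + m) s t).
Proof.
move=> m0 p0 s0.
have p1 : -1 < p by lra.
have pm0 : 0 <= p + m by lra.
(* For x <= t all partial sums are bounded by [K], the exponential weight being monotone. As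
   [fracpow 0] is the indicator of the positive half-line, [g] is an integrable majorant. *)
pose K := 2 * (expR (k * t) * k `^ (- p)).
pose f_ n x := (pospow (m - 1) (t - x) * series (fun i => X i p s x) n)%:E.
pose g x := (pospow (m - 1) (t - x) * (K * fracpow 0 (x - 0)))%:E.
have K0 : 0 <= K by rewrite !mulr_ge0 ?expR_ge0 ?powR_ge0.
have ig : mu.-integrable setT g.
  have := @is_conv_fracpow _ m t 0 0 m0; case; first by lra.
  by move=> h1 h2; have [] := is_convZ K (conj h1 h2).
have mf_ n : measurable_fun setT (f_ n).
  apply/measurable_EFinP; apply: measurable_conv_kernel.
  exact: measurable_picard_series.
have mf : measurable_fun setT (fun x : R => (pospow (m - 1) (t - x) * Y p s x)%:E).
  apply/measurable_EFinP; apply: measurable_conv_kernel.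
  exact: measurable_picard_sum.
have cf x : f_ ^~ x @ \oo --> (pospow (m - 1) (t - x) * Y p s x)%:E.
  apply: cvg_EFin; first exact: nearW.
  by apply: cvgMl_tmp; exact: (picard_sum_cvg alpha0 tau0 k0 small).
have fg x n : (`|f_ n x| <= g x)%E.
  rewrite /f_ /g abse_EFin lee_fin normrM ger0_norm ?pospow_ge0//.
  have [x0|x0] := leP x 0.
    rewrite (_ : series _ n = 0) ?normr0; last first.
      by rewrite /series /= big1// => i _; rewrite picard_le// (le_trans x0).
    have f0 : 0 <= fracpow 0 (x - 0) by apply: fracpow_ge0; lra.
    by rewrite mulr0 mulr_ge0 ?pospow_ge0// mulr_ge0.
  have [xt|xt] := leP t x.
    by rewrite pospow_le0 ?mul0r// subr_le0.
  rewrite ler_wpM2l ?pospow_ge0// subr0 fracpow0// mulr1.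
  apply: le_trans (half_geometric_norm (fun n => bound n x p0 s0) n) _.
  by rewrite ler_wpM2l// ler_wpM2r ?powR_ge0// ler_expR ler_wpM2l ?(ltW k0) ?(ltW xt).
have [||i1 _ i2] := @dominated_convergence _ _ _ mu setT measurableT f_ _ g mf_ mf _ ig _.
- by apply: aeW => x _; exact: cf.
- by apply: aeW => x n _; exact: fg.
split=> //; apply: (cvg_unique (@ereal_hausdorff R) i2).
have -> : [sequence (\int[mu]_(x in setT) f_ n x)%E]_n =
   (fun n => (Gamma m * series (fun i => X i (p + m) s t) n)%:E).
  by apply/funext => n /=; have [_] := @is_conv_picard_series m p s t n m0 p1.
apply: cvg_EFin; first exact: nearW.
by apply: cvgMl_tmp; exact: (picard_sum_cvg alpha0 tau0 k0 small).
Qed.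

(** The partial sums are continuous and converge uniformly on x <= t + 1, because the weight e^(k x)
    is bounded there; the rest is an argument with thirds of [e]. *)
Lemma continuous_picard_sum p s : 0 < p -> 0 <= s -> continuous (Y p s).
Proof.
move=> p0 s0 t; apply/cvgrPdist_le => e e0.
pose M := expR (k * (t + 1)) * k `^ (- p).
have M0 : 0 <= M by rewrite mulr_ge0 ?expR_ge0 ?powR_ge0.
have tail N x : x <= t + 1 ->
    `|Y p s x - series (fun i => X i p s x) N| <= 2 * M * 2^-1 ^+ N.
  move=> xt.
  apply: le_trans (half_geometric_tail (fun n => bound n x (ltW p0) s0) N) _.
  rewrite ler_wpM2r ?exprn_ge0 ?invr_ge0// ler_wpM2l//.
  by rewrite ler_wpM2r ?powR_ge0// ler_expR ler_wpM2l ?(ltW k0).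
have [N HN] : exists N : nat, 2 * M * 2^-1 ^+ N <= e / 3.
  have h : (2 * M) * 2^-1 ^+ n @[n --> \oo] --> (0 : R).
    rewrite -(mulr0 (2 * M)); apply: cvgMl_tmp; apply: cvg_expr.
    by rewrite ger0_norm ?invr_ge0// invf_lt1// ltr1n.
  have /cvgrPdist_le /(_ (e / 3)) := h; case; first by rewrite divr_gt0.
  move=> N _ /(_ N (leqnn N)); rewrite sub0r normrN => H.
  by exists N; exact: le_trans (ler_norm _) H.
have cS : {for t, continuous (fun x => series (fun i => X i p s x) N)}.
  elim: (N) => [|n IH].
    rewrite (_ : (fun x => _) = cst 0); first exact: cvg_cst.
    by apply/funext => x; rewrite /series /= big_geq.
  rewrite (_ : (fun x => _) = (fun x => series (fun i => X i p s x) n + X n p s x)).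
    by apply: cvgD => //; exact: (continuous_picard alpha0).
  by apply/funext => x; rewrite seriesSr.
have /cvgrPdist_le /(_ (e / 3)) := cS; rewrite divr_gt0// => /(_ isT) cSe.
near=> x.
have -> : Y p s t - Y p s x =
  (Y p s t - series (fun i => X i p s t) N) +
  (series (fun i => X i p s t) N - series (fun i => X i p s x) N)
  - (Y p s x - series (fun i => X i p s x) N) by ring.
apply: le_trans (ler_normB _ _) _; apply: le_trans (lerD (ler_normD _ _) (lexx _)) _.
have -> : e = e / 3 + e / 3 + e / 3 by field.
apply: lerD; first apply: lerD.
- by apply: le_trans HN; apply: tail; rewrite lerDl.
- by near: x; exact: cSe.
- apply: le_trans HN; apply: tail; apply: ltW; near: x; apply: lt_nbhsl.
  by rewrite ltrDl.
Unshelve. all: by end_near. Qed.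

End fractional_delay_series_calculus.

(** * Caputo derivatives obtained from convolutions *)

Section caputo_of_conv.
Context {R : realType}.
Notation mu := (@lebesgue_measure R).
Implicit Types (f h : R -> R) (m t : R).

(** For m = 1 the kernel is the indicator of s < y, so [h] is a primitive of [f] and the fundamental
    theorem of calculus applies. *)
Lemma is_derive_is_conv1 f h t : (forall y, is_conv 1 y f (h y)) ->
  {for t, continuous f} -> is_derive t 1 h (f t).
Proof.
move=> fh cf.
have restrE y : (fun s => (pospow (1 - 1) (y - s) * f s)%:E) =
    (EFin \o f) \_ `]-oo, y[.
  apply/funext => s; rewrite patchE subrr.
  case: ifPn; rewrite ?inE ?notin_setE /= in_itv /=.
    by move=> sy; rewrite pospow_gt0 ?subr_gt0// powRr0 mul1r.
  by move=> /negP; rewrite -leNgt => ys; rewrite pospow_le0 ?subr_le0// mul0r.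
have io y : mu.-integrable `]-oo, y[ (EFin \o f).
  by apply/integrable_mkcond => //; rewrite -restrE; have [] := fh y.
have ic y : mu.-integrable `]-oo, y] (EFin \o f).
  apply: integrableS (io (y + 1)) => //.
  by move=> z /=; rewrite !in_itv /= => /le_lt_trans; apply; rewrite ltrDl.
have hE : h = fun y => \int[mu]_(s in `]-oo, y]) f s.
  apply/funext => y; rewrite -Rintegral_itv_bndo_bndc; last exact: io.
  rewrite /Rintegral integral_mkcond.
  by have [_] := fh y; rewrite restrE => ->.
have [||d1 d2] := @continuous_FTC1 R f -oo%O t (t + 1) _ (ic _) _ cf.
- by rewrite ltrDl.
- by rewrite ltNyr.
by rewrite hE; split; [exact: d1|rewrite -derive1E; exact: d2].
Qed.

(** Passes from whole-line convolutions to the Caputo integral over []0, t[]. [F] stands for the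
    actual derivative, known to agree with [f] only for s > 0. *)
Lemma is_conv_itvoo m t f F v : is_conv m t f v -> (forall s : R, s <= 0 -> f s = 0) ->
  (forall s, 0 < s -> F s = f s) ->
  mu.-integrable `]0, t[ (EFin \o (fun s => (t - s) `^ (m - 1) * F s)) /\
  \int[mu]_(s in `]0, t[) ((t - s) `^ (m - 1) * F s) = v.
Proof.
move=> [i e] f0 Ff.
have E : (EFin \o (fun s => (t - s) `^ (m - 1) * F s)) \_ `]0, t[ =
   (fun s => (pospow (m - 1) (t - s) * f s)%:E).
  apply/funext => s; rewrite patchE.
  case: ifPn; rewrite ?inE ?notin_setE /= in_itv /=.
    by move=> /andP[s0 st]; rewrite Ff// pospow_gt0// subr_gt0.
  move=> /negP; rewrite negb_and -!leNgt => /orP[s0|ts].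
    by rewrite f0// mulr0.
  by rewrite pospow_le0 ?mul0r// subr_le0.
split; first by apply/integrable_mkcond => //; rewrite E.
by rewrite /Rintegral integral_mkcond E e.
Qed.

Lemma caputo_order1 (al : R) : 0 < al <= 1 -> caputo_order al = 1%N.
Proof.
move=> /andP[a0 a1]; rewrite /caputo_order.
by have -> : Num.ceil al = 1 by apply: ceil_def; rewrite subrr a0.
Qed.

Lemma caputo_order2 (al : R) : 1 < al <= 2 -> caputo_order al = 2%N.
Proof.
move=> /andP[a0 a1]; rewrite /caputo_order.
have -> // : Num.ceil al = 2%:Z.
by apply: ceil_def; rewrite a1 andbT.
Qed.

(** The Caputo derivative of order below 1 is the fractional integral of order [1 - al] of [dx]; the
    factor [Gamma (1 - al)] cancels the prefactor. *)
Lemma caputo_differentiable1 (al : R) (x dx v : R -> R) : 0 < al < 1 ->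
  (forall s : R, 0 < s -> is_derive s (1 : R) x (dx s)) ->
  (forall s : R, s <= 0 -> dx s = 0) ->
  (forall t, 0 < t -> is_conv (1 - al) t dx (Gamma (1 - al) * v t)) ->
  caputo_differentiable al x /\ forall t, 0 < t -> caputo al x t = v t.
Proof.
move=> /andP[a0 a1] xdx dx0 cdx.
have oE : caputo_order al = 1%N by rewrite caputo_order1// a0 ltW.
have dE (s : R) : 0 < s -> derive1n 1 x s = dx s.
  by move=> s0; rewrite derive1n1 derive1E; have [_ ->] := xdx s s0.
have neq : al == 1%:R = false by rewrite lt_eqF.
rewrite /caputo_differentiable /caputo /caputo_integrand oE neq; split; [split|].
- by case=> [|n] s // _ s0; have [] := xdx s s0.
- by move=> _ t t0; have [] := is_conv_itvoo (cdx t t0) dx0 dE.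
move=> t t0; have [_ ->] := is_conv_itvoo (cdx t t0) dx0 dE.
by rewrite mulKf// gt_eqF// Gamma_gt0// subr_gt0.
Qed.

Lemma caputo_differentiable2 (al : R) (x dx ddx v : R -> R) : 1 < al < 2 ->
  (forall s : R, 0 < s -> is_derive s (1 : R) x (dx s)) ->
  (forall s : R, 0 < s -> is_derive s (1 : R) dx (ddx s)) ->
  (forall s : R, s <= 0 -> ddx s = 0) ->
  (forall t, 0 < t -> is_conv (2 - al) t ddx (Gamma (2 - al) * v t)) ->
  caputo_differentiable al x /\ forall t, 0 < t -> caputo al x t = v t.
Proof.
move=> /andP[a0 a1] xdx dxddx ddx0 cddx.
have oE : caputo_order al = 2%N by rewrite caputo_order2// a0 ltW.
have dE (s : R) : 0 < s -> derive1 x s = dx s.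
  by move=> s0; rewrite derive1E; have [_ ->] := xdx s s0.
(* [derive1 x] equals [dx] only on the positive half-line, so its derivative is transferred by
   equality near [s]. *)
have d2 (s : R) : 0 < s -> is_derive s (1 : R) (derive1 x) (ddx s).
  move=> s0; have := dxddx s s0.
  apply: near_eq_is_derive.
  near=> y; apply/esym/dE; near: y; exact: lt_nbhsr.
have ddE (s : R) : 0 < s -> derive1n 2 x s = ddx s.
  by move=> s0; rewrite derive1nS derive1n1 derive1E; have [_ ->] := d2 s s0.
have neq : al == 2%:R = false by rewrite lt_eqF.
rewrite /caputo_differentiable /caputo /caputo_integrand oE neq; split; [split|].
- case=> [|[|n]] s // _ s0; first by have [] := xdx s s0.
  by have [] := d2 s s0.
- by move=> _ t t0; have [] := is_conv_itvoo (cddx t t0) ddx0 ddE.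
move=> t t0; have [_ ->] := is_conv_itvoo (cddx t t0) ddx0 ddE.
by rewrite mulKf// gt_eqF// Gamma_gt0// subr_gt0.
Unshelve. all: by end_near. Qed.

End caputo_of_conv.

(** * Differentiating the series, including negative exponents *)

Section fractional_delay_series_derivatives.
Context {R : realType}.
Variables (alpha A B C tau k : R).
Hypotheses (alpha0 : 0 < alpha) (tau0 : 0 <= tau) (k0 : 0 < k).
Hypothesis small : (`|A| + `|B|) * k `^ (- (2 * alpha)) + `|C| * k `^ (- alpha) <= 2^-1.
Implicit Types (p s t m : R).

Local Notation Y := (picard_sum alpha A B C tau).
Local Notation YE := (picard_sumE alpha0 tau0 k0 small).
Local Notation convY := (is_conv_picard_sum alpha0 tau0 k0 small).
Local Notation contY := (continuous_picard_sum alpha0 tau0 k0 small).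

(* One Picard step moves the exponents into the range of [is_conv_picard_sum]. *)
Lemma is_conv_picard_sumW m p s t : 0 < m -> -1 < p -> 0 <= p + alpha -> 0 <= s ->
  is_conv m t (Y p s) (Gamma m * Y (p + m) s t).
Proof.
move=> m0 p1 pa s0; have a0 := alpha0.
have st0 : 0 <= s + tau by exact: addr_ge0.
have p2a : 0 <= p + 2 * alpha by lra.
have -> : Y p s = fun x => fracpow p (x - s) + A * Y (p + 2 * alpha) s x +
    B * Y (p + 2 * alpha) (s + tau) x + C * Y (p + alpha) s x.
  by apply/funext => x; exact: YE.
have -> : Gamma m * Y (p + m) s t =
    Gamma m * fracpow (p + m) (t - s) + A * (Gamma m * Y (p + 2 * alpha + m) s t) +
    B * (Gamma m * Y (p + 2 * alpha + m) (s + tau) t) +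
    C * (Gamma m * Y (p + alpha + m) s t).
  rewrite YE//; last by lra.
  rewrite !(addrAC p m).
  move: (Gamma m) (fracpow _ _) (Y _ _ _) (Y _ _ _) (Y _ _ _) => g w x y z.
  ring.
apply: is_convD; first apply: is_convD; first apply: is_convD.
- exact: is_conv_fracpow.
- by apply: is_convZ; exact: convY.
- by apply: is_convZ; exact: convY.
- by apply: is_convZ; exact: convY.
Qed.

(** After one Volterra expansion only the leading power can be singular, and only at t = s; the
    other exponents are positive. *)
Lemma continuous_picard_sum_gt p s t : 0 < p + alpha -> 0 <= s -> s < t ->
  {for t, continuous (Y p s)}.
Proof.
move=> pa s0 st; have a0 := alpha0.
have st0 : 0 <= s + tau by exact: addr_ge0.
have -> : Y p s = fun x => fracpow p (x - s) + A * Y (p + 2 * alpha) s x +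
    B * Y (p + 2 * alpha) (s + tau) x + C * Y (p + alpha) s x.
  by apply/funext => x; apply: YE => //; exact: ltW.
apply: cvgD; first apply: cvgD; first apply: cvgD.
- apply: (@continuous_comp _ _ _ (fun t : R => t - s) (fracpow p)).
    by apply: cvgB; [exact: cvg_id|exact: cvg_cst].
  by apply: continuous_fracpow_gt0; rewrite subr_gt0.
- by apply: cvgMl_tmp; apply: contY => //; lra.
- by apply: cvgMl_tmp; apply: contY => //; lra.
- by apply: cvgMl_tmp; apply: contY => //; lra.
Qed.

(** Integration of order 1 raises the exponent by 1, so the left function is a primitive of the
    right one. *)
Lemma is_derive_picard_sum p s t : 0 < p -> 0 <= s ->
  is_derive t (1 : R) (Y (p + 1) s) (Y p s t).
Proof.
move=> p0 s0; apply: is_derive_is_conv1; last exact: contY.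
move=> y; have := @convY 1 p s y ltr01 (ltW p0) s0.
by rewrite Gamma1 mul1r.
Qed.

Lemma is_derive_picard_sum_gt p s t : -1 < p -> 0 < p + alpha -> 0 <= s -> s < t ->
  is_derive t (1 : R) (Y (p + 1) s) (Y p s t).
Proof.
move=> p1 pa s0 st; apply: is_derive_is_conv1; last exact: continuous_picard_sum_gt.
move=> y; have := @is_conv_picard_sumW 1 p s y ltr01 p1 (ltW pa) s0.
by rewrite Gamma1 mul1r.
Qed.

End fractional_delay_series_derivatives.

(** * The series with p = 1 and s = 0 solves the fractional delay equation *)

Section unbounded_solution.
Context {R : realType}.
Variables (a b c alpha tau k : R).
Hypotheses (c0 : 0 < c) (alpha12 : 1 / 2 < alpha < 1) (tau0 : 0 <= tau) (k0 : 0 < k).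
Local Notation A := (a / c).
Local Notation B := (b / c).
Local Notation C := (- c^-1).
Hypothesis small : (`|A| + `|B|) * k `^ (- (2 * alpha)) + `|C| * k `^ (- alpha) <= 2^-1.

Local Notation Y := (picard_sum alpha A B C tau).

Let alpha0 : 0 < alpha.
Proof. by move/andP: alpha12 => [h _]; lra. Qed.

Let dx := Y 0 0.
(** Formally this is [Y (- 1) 0], whose leading exponent is out of range. It is instead the Volterra
    expansion of [Y 0 0] differentiated termwise for t > 0, where the leading term is the constant
    1. *)
Let ddx (t : R) := A * Y (2 * alpha - 1) 0 t + B * Y (2 * alpha - 1) tau t
  + C * Y (alpha - 1) 0 t.
Let YE := picard_sumE alpha0 tau0 k0 small.

Lemma picard_sum1_derive (t : R) : 0 < t -> is_derive t (1 : R) (Y 1 0) (dx t).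
Proof.
move=> t0; have := @is_derive_picard_sum_gt _ _ _ _ _ _ _ alpha0 tau0 k0 small 0 0 t.
by rewrite !add0r; apply=> //; lra.
Qed.

Lemma picard_sum0_derive (t : R) : 0 < t -> is_derive t (1 : R) (Y 0 0) (ddx t).
Proof.
move=> t0; have /andP[h1 h2] := alpha12.
have -> : Y 0 0 = fun x => fracpow 0 (x - 0) + A * Y (2 * alpha) 0 x +
    B * Y (2 * alpha) tau x + C * Y alpha 0 x.
  apply/funext => x; rewrite YE// ?add0r ?ltW//.
have d0 : is_derive t (1 : R) (fun x => fracpow 0 (x - 0)) 0.
  apply: near_eq_is_derive (is_derive_cst (1 : R) t (1 : R)).
  by near=> y; rewrite subr0 fracpow0//; near: y; exact: lt_nbhsr.
have e1 : 2 * alpha - 1 + 1 = 2 * alpha by ring.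
have e2 : alpha - 1 + 1 = alpha by ring.
have p0 : 0 < 2 * alpha - 1 by lra.
have d1 := @is_derive_picard_sum _ _ _ _ _ _ _ alpha0 tau0 k0 small (2 * alpha - 1) 0 t p0 (lexx 0).
have d2 := @is_derive_picard_sum _ _ _ _ _ _ _ alpha0 tau0 k0 small (2 * alpha - 1) tau t p0 tau0.
(* The exponent [alpha - 1] is negative, hence the variant away from 0; its condition
   [0 < alpha - 1 + alpha] is alpha > 1/2. *)
have d3 := @is_derive_picard_sum_gt _ _ _ _ _ _ _ alpha0 tau0 k0 small (alpha - 1) 0 t.
have {}d3 : is_derive t (1 : R) (Y (alpha - 1 + 1) 0) (Y (alpha - 1) 0 t).
  by apply: d3 => //; lra.
rewrite e1 in d1 d2; rewrite e2 in d3.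
have := is_deriveD (is_deriveD (is_deriveD d0 (is_deriveZ A d1))
  (is_deriveZ B d2)) (is_deriveZ C d3).
by rewrite add0r.
Unshelve. all: by end_near. Qed.

Lemma caputo_picard_sum_alpha : caputo_differentiable alpha (Y 1 0) /\
  forall t, 0 < t -> caputo alpha (Y 1 0) t = Y (1 - alpha) 0 t.
Proof.
have /andP[h1 h2] := alpha12.
apply: (@caputo_differentiable1 _ alpha (Y 1 0) dx).
- by apply/andP; split=> //; lra.
- exact: picard_sum1_derive.
- by move=> s s0; exact: picard_sum_le.
- move=> t t0; have := @is_conv_picard_sum _ _ _ _ _ _ _ alpha0 tau0 k0 small (1 - alpha) 0 0 t.
  by rewrite add0r; apply=> //; rewrite subr_gt0.
Qed.

(** Integrating [ddx] to order 2 - 2 alpha turns the exponents 2 alpha - 1 and alpha - 1 into 1 and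
    1 - alpha. The last term is the derivative of order alpha, so this is the equation divided by
    [c]. *)
Lemma caputo_picard_sum_2alpha : caputo_differentiable (2 * alpha) (Y 1 0) /\
  forall t, 0 < t -> caputo (2 * alpha) (Y 1 0) t =
    A * Y 1 0 t + B * Y 1 tau t + C * Y (1 - alpha) 0 t.
Proof.
have /andP[h1 h2] := alpha12.
apply: (@caputo_differentiable2 _ (2 * alpha) (Y 1 0) dx ddx).
- by apply/andP; split=> //; lra.
- exact: picard_sum1_derive.
- exact: picard_sum0_derive.
- move=> s s0; rewrite /ddx !picard_sum_le ?mulr0 ?addr0//.
  exact: le_trans tau0.
- move=> t t0.
  rewrite !mulrDr !(mulrCA (Gamma _)).
  have e1 : (1 : R) = 2 * alpha - 1 + (2 - 2 * alpha) by ring.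
  have e2 : 1 - alpha = alpha - 1 + (2 - 2 * alpha) by ring.
  rewrite [in Y 1 0 t]e1 [in Y 1 tau t]e1 e2.
  apply: is_convD; first apply: is_convD; apply: is_convZ;
    apply: (is_conv_picard_sumW alpha0 tau0 k0 small) => //; lra.
Qed.

(** By the Volterra equation the solution is h + r(h) for h > 0, where all exponents in [r] exceed
    1, so r'(0) = 0. *)
Lemma picard_sum1_slope : h^-1 * (Y 1 0 h - Y 1 0 0) @[h --> 0^'+] --> (1 : R).
Proof.
have /andP[h1 h2] := alpha12.
pose r (x : R) := A * Y (2 * alpha + 1) 0 x + B * Y (2 * alpha + 1) tau x + C * Y (alpha + 1) 0 x.
have r0 : is_derive 0 (1 : R) r 0.
  have p2 : 0 < 2 * alpha by lra.
  have d1 := @is_derive_picard_sum _ _ _ _ _ _ _ alpha0 tau0 k0 small (2 * alpha) 0 0 p2 (lexx 0).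
  have d2 := @is_derive_picard_sum _ _ _ _ _ _ _ alpha0 tau0 k0 small (2 * alpha) tau 0 p2 tau0.
  have d3 := @is_derive_picard_sum _ _ _ _ _ _ _ alpha0 tau0 k0 small alpha 0 0 alpha0 (lexx 0).
  have := is_deriveD (is_deriveD (is_deriveZ A d1) (is_deriveZ B d2)) (is_deriveZ C d3).
  by rewrite !picard_sum_le// !scaler0 !addr0.
have r00 : r 0 = 0 by rewrite /r !picard_sum_le// !mulr0 !addr0.
have E (h : R) : 0 < h -> h^-1 * (Y 1 0 h - Y 1 0 0) = 1 + h^-1 *: ((r \o shift 0) (h *: 1) - r 0).
  move=> hp; have -> : Y 1 0 0 = 0 by exact: picard_sum_le.
  rewrite YE//; last by have := alpha0; lra.
  rewrite /= addr0 r00 !subr0 add0r [h *: 1]mulr1 /GRing.scale /= !(addrC 1).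
  rewrite /fracpow (addrC 1) Gamma2 pospow_gt0// powRr1 ?ltW// divr1 /r.
  by field; rewrite (gt_eqF c0) (gt_eqF hp).
have [dr er] := r0.
have dr0 : (fun h : R => h^-1 *: ((r \o shift 0) (h *: 1) - r 0)) @ 0^' --> (0 : R).
  by rewrite -[X in _ --> X]er; exact: dr.
have : (1 + h^-1 *: ((r \o shift 0) (h *: 1) - r 0)) @[h --> 0^'+] --> (1 : R).
  rewrite -[X in _ --> X]addr0; apply: cvgD; first exact: cvg_cst.
  exact: cvg_dnbhs_at_right dr0.
apply: cvg_trans; apply: near_eq_cvg; near=> h; rewrite E//.
Unshelve. all: by end_near. Qed.

End unbounded_solution.

(** * Laplace transforms of bounded functions, shifts and fractional integrals *)

Section laplace_transform.
Context {R : realType}.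
Notation mu := (@lebesgue_measure R).
Implicit Types (f h : R -> R) (lam p m r t u v w : R).

Definition has_laplace (lam : R) f v : Prop :=
  mu.-integrable setT (fun t => (expR (- (lam * t)) * f t)%:E) /\
  laplace lam f = v%:E.

Lemma has_laplace_unique lam f v w :
  has_laplace lam f v -> has_laplace lam f w -> v = w.
Proof. by move=> [_ e1] [_]; rewrite e1 => -[]. Qed.

Lemma has_laplaceD lam f h v w : has_laplace lam f v -> has_laplace lam h w ->
  has_laplace lam (fun t => f t + h t) (v + w).
Proof.
move=> [i1 e1] [i2 e2]; rewrite /has_laplace /laplace.
have -> : (fun t => (expR (- (lam * t)) * (f t + h t))%:E) =
  (fun t => (expR (- (lam * t)) * f t)%:E) \+
  (fun t => (expR (- (lam * t)) * h t)%:E).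
  by apply/funext => t /=; rewrite mulrDr EFinD.
split; first exact: integrableD.
by rewrite integralD//; rewrite /laplace in e1 e2; rewrite e1 e2.
Qed.

Lemma has_laplaceZ lam f v r : has_laplace lam f v ->
  has_laplace lam (fun t => r * f t) (r * v).
Proof.
move=> [i e]; rewrite /has_laplace /laplace.
have -> : (fun t => (expR (- (lam * t)) * (r * f t))%:E) =
  (fun t => r%:E * (expR (- (lam * t)) * f t)%:E)%E.
  by apply/funext => t /=; rewrite -EFinM mulrCA.
split; first exact: integrableZl.
by rewrite integralZl//; rewrite /laplace in e; rewrite e.
Qed.

Lemma laplace_pospowE lam p : 0 < lam -> -1 < p ->
  laplace lam (pospow p) = (lam `^ (- (p + 1)) * Gamma (p + 1))%:E.
Proof.
move=> l0 p1; have p0 : 0 < p + 1 by lra.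
by rewrite EFinM -(laplace1_pospow p0) addrK laplace_pospow.
Qed.

Lemma has_laplace_pospow lam p : 0 < lam -> -1 < p ->
  has_laplace lam (pospow p) (lam `^ (- (p + 1)) * Gamma (p + 1)).
Proof.
move=> l0 p1; split; last exact: laplace_pospowE.
apply/integrableP; split.
  by apply: measurable_laplace; exact: measurable_pospow.
under eq_integral do rewrite abse_EFin ger0_norm ?mulr_ge0 ?expR_ge0 ?pospow_ge0//.
by rewrite -/(laplace lam (pospow p)) laplace_pospowE// ltry.
Qed.

(** The function is dominated by [M] times the indicator [pospow 0]. *)
Lemma has_laplace_bounded lam f (M : R) : 0 < lam -> measurable_fun setT f ->
  (forall t, `|f t| <= M) -> (forall t, t <= 0 -> f t = 0) ->
  exists v, has_laplace lam f v.
Proof.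
move=> l0 mf fM f0.
have i : mu.-integrable setT (fun t => (expR (- (lam * t)) * f t)%:E).
  have [ig _] := has_laplaceZ M (@has_laplace_pospow lam 0 l0 (ltrN10 _)).
  apply: le_integrable ig => //; first exact: measurable_laplace.
  move=> t _; rewrite !abse_EFin lee_fin !normrM ler_wpM2l//.
  have [t0|t0] := leP t 0; first by rewrite f0// normr0 mulr_ge0.
  rewrite pospow_gt0// powRr0 normr1 mulr1.
  exact: le_trans (fM t) (ler_norm _).
exists (fine (laplace lam f)); split=> //; rewrite fineK//.
exact: integrable_fin_num.
Qed.

Lemma integral_shift (u : R) (F : R -> \bar R) : measurable_fun setT F ->
  (\int[mu]_x F (x - u)%R = \int[mu]_x F x)%E.
Proof.
move=> mF; rewrite integralE [RHS]integralE; congr (_ - _)%E.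
  transitivity (\int[mu]_x (F^\+ (x - u)%R))%E.
    by apply: eq_integral => x _; rewrite !funeposE.
  apply: ge0_integral_shift; last by move=> x; exact: funepos_ge0.
  exact: measurable_funepos.
transitivity (\int[mu]_x (F^\- (x - u)%R))%E.
  by apply: eq_integral => x _; rewrite !funenegE.
apply: ge0_integral_shift; last by move=> x; exact: funeneg_ge0.
exact: measurable_funeneg.
Qed.

Lemma has_laplace_shift lam f v w u : measurable_fun setT f ->
  has_laplace lam f v -> has_laplace lam (fun t => f (t - u)) w ->
  w = expR (- (lam * u)) * v.
Proof.
move=> mf [i e] [_ e']; apply: EFin_inj; rewrite -e'.
pose G s := ((expR (- (lam * u)))%:E * (expR (- (lam * s)) * f s)%:E)%E.
transitivity (\int[mu]_t G (t - u)%R)%E.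
  apply: eq_integral => t _; rewrite /G -EFinM mulrA -expRD.
  by congr (expR _ * _)%:E; ring.
rewrite integral_shift; last by apply: measurable_funeM; exact: measurable_laplace.
by rewrite /G integralZl// -/(laplace lam f) e EFinM.
Qed.

(** The convolution theorem for signed [f]: Tonelli applied to the absolute value of [f] gives joint
    integrability, after which Fubini exchanges the integrals. *)
Lemma has_laplace_conv lam m f h v (M : R) : 0 < lam -> 0 < m ->
  measurable_fun setT f ->
  (forall t, `|f t| <= M) -> (forall t, t <= 0 -> f t = 0) ->
  (forall t, is_conv m t f (h t)) -> has_laplace lam f v ->
  has_laplace lam h (lam `^ (- m) * Gamma m * v).
Proof.
move=> l0 m0 mf fM f0 fh [iv ev].
have m1 : -1 < m - 1 by lra.
pose K (z : R * R) :=
  (expR (- (lam * z.1)) * (pospow (m - 1) (z.1 - z.2) * f z.2))%:E.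
have mK : measurable_fun setT K.
  by apply/measurable_EFinP; exact: measurable_laplace_kernel.
have Lp := laplace_pospowE l0 m1; rewrite subrK in Lp.
have iK : (mu \x mu)%E.-integrable setT K.
  apply/integrable12ltyP => //.
  have mnf : measurable_fun setT (fun s => `|f s|) by exact: measurableT_comp.
  have := laplace_conv lam (m - 1) mnf (fun s => normr_ge0 _).
  have [||w [_ Lw]] := @has_laplace_bounded lam (fun s => `|f s|) M l0 mnf.
  - by move=> t; rewrite normr_id.
  - by move=> t t0; rewrite f0// normr0.
  rewrite Lp Lw -EFinM => e.
  rewrite (_ : (fun x => _) = (fun t => \int[mu]_s (expR (- (lam * t)) *
     (pospow (m - 1) (t - s) * `|f s|))%:E)%E).
    by rewrite e ltry.
  apply/funext => t; apply: eq_integral => s _; rewrite /K abse_EFin !normrM.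
  by rewrite !(ger0_norm (expR_ge0 _)) (ger0_norm (pospow_ge0 _ _)).
have FE t : (\int[mu]_s K (t, s) = (expR (- (lam * t)) * h t)%:E)%E.
  have [i e] := fh t; rewrite /K /=.
  under eq_integral do rewrite EFinM.
  by rewrite integralZl// e.
have GE s : (\int[mu]_t K (t, s) =
    (lam `^ (- m) * Gamma m)%:E * (expR (- (lam * s)) * f s)%:E)%E.
  have e := integral_laplace_kernel lam (m - 1) s.
  have i : mu.-integrable setT (fun t => (expR (- (lam * t)) * pospow (m - 1) (t - s))%:E).
    apply/integrableP; split.
      apply/measurable_EFinP; apply: measurable_funM; first exact: measurable_expRN.
      exact: (@measurable_shift_fun _ (pospow (m - 1)) s (measurable_pospow _)).
    under eq_integral do rewrite abse_EFin ger0_norm ?mulr_ge0 ?expR_ge0 ?pospow_ge0//.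
    by rewrite e Lp -EFinM ltry.
  transitivity (\int[mu]_t ((f s)%:E *
      (expR (- (lam * t)) * pospow (m - 1) (t - s))%:E))%E.
    by apply: eq_integral => t _; rewrite /K /= -EFinM mulrA mulrC.
  rewrite integralZl// e Lp -!EFinM; congr EFin.
  move: (Gamma m) (lam `^ _) => g1 g2; ring.
split.
  by apply: eq_integrable (integrable_fubini_F iK) => // t _; exact: FE.
rewrite /laplace.
transitivity (\int[mu]_t \int[mu]_s K (t, s))%E.
  by apply: eq_integral => t _; rewrite FE.
rewrite (Fubini iK).
under eq_integral do rewrite GE.
rewrite integralZl//.
by rewrite -/(laplace lam f) ev -EFinM.
Qed.

End laplace_transform.

(** * A positive characteristic root and the choice of the weight *)

Section characteristic_root.
Context {R : realType}.
Variables (a b c alpha tau : R).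
Hypotheses (c0 : 0 < c) (alpha0 : 0 < alpha) (tau0 : 0 <= tau) (ba : `|b| < a).

Lemma exists_characteristic_root : exists2 lam : R, 0 < lam &
  lam `^ alpha + c * lam `^ (2 * alpha) = a + b * expR (- (lam * tau)).
Proof.
have c0' := c0; have ba' := ba.
(* substituting u = lam ^ alpha makes the intermediate value interval explicit *)
pose f (u : R) := u + c * (u * u) - a - b * expR (- (u `^ alpha^-1 * tau)).
pose d := a - `|b|; have d0 : 0 < d by rewrite subr_gt0.
(* This choice gives u1 <= 1 and (1 + c) u1 <= d, hence u1 + c u1^2 <= d, which is at most a + b
   e^(...). At [u2] the linear term alone exceeds a + |b|. *)
pose u1 := d / ((1 + c) * (1 + d)).
pose u2 := 1 + a + `|b|.
have D0 : 0 < (1 + c) * (1 + d) by apply: mulr_gt0; lra.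
have u10 : 0 < u1 by exact: divr_gt0.
have u1E : u1 * ((1 + c) * (1 + d)) = d by rewrite /u1 mulfVK// gt_eqF.
have nb0 : 0 <= `|b| by [].
have u11 : u1 <= 1 by rewrite ler_pdivrMr//; nra.
clearbody u1.
have fb (u : R) : 0 < u -> `|b * expR (- (u `^ alpha^-1 * tau))| <= `|b|.
  move=> u0; rewrite normrM ler_piMr// ger0_norm ?expR_ge0//.
  by rewrite -expR0 ler_expR oppr_le0 mulr_ge0 ?powR_ge0.
have u20 : 0 < u2 by rewrite /u2; lra.
have u21 : 1 <= u2 by rewrite /u2; lra.
have ua : a + `|b| <= u2 by rewrite /u2; lra.
clearbody u2.
have f1 : f u1 <= 0.
  have := fb _ u10; rewrite ler_norml => /andP[+ _]; rewrite /f.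
  set z := b * _ => hz.
  have h1 : u1 * (1 + c) <= d.
    have c1 : 0 <= 1 + c by lra.
    have h0 := mulr_ge0 (mulr_ge0 (ltW u10) c1) (ltW d0).
    have e : u1 * (1 + c) + u1 * (1 + c) * d = d.
      by rewrite -[RHS]u1E; ring.
    by rewrite -[leRHS]e lerDl.
  have h2 : c * (u1 * u1) <= c * u1.
    by rewrite ler_wpM2l ?(ltW c0)// ler_piMr// ltW.
  rewrite /d in h1; lra.
have f2 : 0 <= f u2.
  have := fb _ u20; rewrite ler_norml => /andP[_ +]; rewrite /f.
  set z := b * _ => hz.
  have h2 := mulr_ge0 (ltW c0) (mulr_ge0 (ltW u20) (ltW u20)).
  lra.
have u12 := le_trans u11 u21.
have cf : {within `[u1, u2], continuous f}.
  apply: continuous_in_subspaceT => u; rewrite inE /= in_itv /= => /andP[hu _].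
  have u0 : 0 < u by exact: lt_le_trans hu.
  apply: cvgB; first apply: cvgB; first apply: cvgD.
  - exact: cvg_id.
  - by apply: cvgMl_tmp; apply: cvgM; exact: cvg_id.
  - exact: cvg_cst.
  apply: cvgMl_tmp.
  apply: (@continuous_comp _ _ _ (fun u : R => - (u `^ alpha^-1 * tau)) expR);
    last exact: continuous_expR.
  apply: cvgN; apply: cvgMr_tmp.
  have : {for u, continuous (fun v : R => v `^ alpha^-1)}; last exact.
  by apply/differentiable_continuous/derivable1_diffP; apply: derivable_powR;
    rewrite in_itv /= u0.
have fE u : f u = u + c * (u * u) - a - b * expR (- (u `^ alpha^-1 * tau)) by [].
clearbody f.
have [|u /itvP uI fu] := IVT u12 cf (v := 0).
  by rewrite ge_min f1 le_max f2 orbT.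
have u0 : 0 < u by apply: lt_le_trans u10 _; rewrite uI.
exists (u `^ alpha^-1); first exact: powR_gt0.
have e1 : (u `^ alpha^-1) `^ alpha = u.
  by rewrite -powRrM mulVf ?gt_eqF// powRr1// ltW.
have -> : 2 * alpha = alpha * 2%:R by ring.
rewrite powRrM e1 powR_mulrn ?(ltW u0)//.
by apply/eqP; rewrite -subr_eq0 -fu fE; apply/eqP; ring.
Qed.

(** Choose [k] with k^(- alpha) = u = 1 / (2 (D + 1)). As u <= 1, its square is at most u, and the
    left side is at most D u <= 1/2. *)
Lemma exists_small_factor (A B C : R) : exists2 k : R, 0 < k &
  (`|A| + `|B|) * k `^ (- (2 * alpha)) + `|C| * k `^ (- alpha) <= 2^-1.
Proof.
pose D := `|A| + `|B| + `|C|.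
have D0 : 0 <= D by rewrite !addr_ge0.
pose u := (2 * (D + 1))^-1.
have u0 : 0 < u by rewrite invr_gt0; lra.
exists (u `^ (- alpha^-1)); first exact: powR_gt0.
have e1 : (u `^ (- alpha^-1)) `^ (- alpha) = u.
  by rewrite -powRrM mulrNN mulVf ?gt_eqF// powRr1// ltW.
have -> : - (2 * alpha) = (- alpha) * 2%:R by ring.
rewrite powRrM e1 powR_mulrn ?(ltW u0)//.
have uE : u * (2 * (D + 1)) = 1 by rewrite mulVf// gt_eqF//; lra.
have u1 : u <= 1 by nra.
have : (`|A| + `|B|) * u ^+ 2 <= (`|A| + `|B|) * u.
  by rewrite ler_wpM2l ?addr_ge0// expr2 ler_piMr// ltW.
have : D * u <= 2^-1 by lra.
rewrite /D; lra.
Qed.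

End characteristic_root.

(** * Instability for every delay by Laplace transform *)

Section instability.
Context {R : realType}.
Variables (a b c alpha tau : R).
Hypotheses (c0 : 0 < c) (alpha12 : 1 / 2 < alpha < 1) (tau0 : 0 <= tau) (ba : `|b| < a).

Lemma unstable_delay : unstable a b c alpha tau.
Proof.
have alpha0 : 0 < alpha by move/andP: alpha12 => [h _]; lra.
have [k k0 small] := exists_small_factor alpha0 (a / c) (b / c) (- c^-1).
have [lam l0 lamE] := exists_characteristic_root c0 alpha0 tau0 ba.
pose Y := picard_sum alpha (a / c) (b / c) (- c^-1) tau.
pose x := Y 1 0.
have cx : continuous x by exact: (continuous_picard_sum alpha0 tau0 k0 small).
have [cd1 ce1] := caputo_picard_sum_alpha alpha12 tau0 k0 small.
have [cd2 ce2] := caputo_picard_sum_2alpha alpha12 tau0 k0 small.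
have shiftY p t : Y p tau t = Y p 0 (t - tau).
  by rewrite -[in LHS](add0r tau); exact: picard_sum_shift.
have sol : is_solution a b c alpha tau (cst 0) 1 x.
  split.
  - by move=> t /andP[_ t0]; exact: picard_sum_le.
  - exact: continuous_subspaceT.
  - exact: (picard_sum1_slope c0 alpha12 tau0 k0 small).
  - by split.
  - move=> t t0; rewrite ce1// ce2// -/(Y 1 0) -/(Y 1 tau) shiftY /x.
    move: (Y 1 0 t) (Y 1 0 (t - tau)) => y z.
    by field; rewrite gt_eqF.
move=> /(_ (cst 0) 1 x (continuous_subspaceT (@cst_continuous _ _ 0)) sol).
move=> bx.
(* Boundedness near infinity becomes a global bound: up to [t0] the increasing exponential bound of
   the series takes over. *)
have [M xM] : exists M : R, forall t, `|x t| <= M.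
  have [M [_ HM]] := bx.
  have [t0 [_ Ht0]] := HM (M + 1) (ltr_pwDr ltr01 (lexx M)).
  exists (Num.max (M + 1) (2 * (expR (k * t0) * k `^ (- 1)))) => t.
  rewrite le_max; have [tt0|tt0] := ltP t0 t.
    by rewrite Ht0.
  apply/orP; right.
  apply: le_trans (picard_sum_bound alpha0 tau0 k0 small t ler01 (lexx 0)) _.
  by rewrite ler_wpM2l// ler_wpM2r ?powR_ge0// ler_expR ler_wpM2l ?(ltW k0).
have xle t : t <= 0 -> x t = 0 by exact: picard_sum_le.
have mx : measurable_fun setT x by exact: continuous_measurable_fun.
pose y := fun t => x (t - tau).
have my : measurable_fun setT y by exact: measurable_shift_fun.
have yM t : `|y t| <= M by exact: xM.
have yle t : t <= 0 -> y t = 0.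
  by move=> t0; apply: xle; rewrite subr_le0 (le_trans t0).
have [v xv] := has_laplace_bounded l0 mx xM xle.
have [w yw] := has_laplace_bounded l0 my yM yle.
have wE := has_laplace_shift mx xv yw.
have p1 : (0 : R) <= 1 by [].
(* Fractional integration of order m multiplies the transform by lam^(-m). A general start [s]
   covers both the solution and its delayed copy. *)
have L m s f z : 0 < m -> 0 <= s -> Y 1 s = f -> measurable_fun setT f ->
    (forall t, `|f t| <= M) -> (forall t, t <= 0 -> f t = 0) ->
    has_laplace lam f z -> has_laplace lam (Y (1 + m) s) (lam `^ (- m) * z).
  move=> m0 s0 fE mf fM f0 fz.
  have G0 : 0 < Gamma m by exact: Gamma_gt0.
  have h t : is_conv m t f (Gamma m * Y (1 + m) s t).
    rewrite -fE; exact: (is_conv_picard_sum alpha0 tau0 k0 small).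
  have := has_laplaceZ (Gamma m)^-1 (has_laplace_conv l0 m0 mf fM f0 h fz).
  rewrite (_ : (fun t => _) = Y (1 + m) s); last first.
    by apply/funext => t; rewrite mulKf// gt_eqF.
  rewrite (_ : (Gamma m)^-1 * _ = lam `^ (- m) * z); first exact.
  by move: (Gamma m) (lam `^ _) G0 => g l g0; field; rewrite (gt_eqF g0).
have a2 : 0 < 2 * alpha by lra.
have yE : Y 1 tau = y by apply/funext => t; exact: shiftY.
have L1 := L _ 0 x v a2 (lexx 0) erefl mx xM xle xv.
have L2 := L _ tau y w a2 tau0 yE my yM yle yw.
have L3 := L _ 0 x v alpha0 (lexx 0) erefl mx xM xle xv.
have L0 := has_laplaceZ (Gamma (1 + 1))^-1 (@has_laplace_pospow _ lam 1 l0 (lt_trans (ltrN10 _) ltr01)).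
(* Transform of the right side of the Volterra equation; [L0] contributes lam^(-2), the transform of
   t. *)
have := has_laplaceD (has_laplaceD (has_laplaceD L0 (has_laplaceZ (a / c) L1))
  (has_laplaceZ (b / c) L2)) (has_laplaceZ (- c^-1) L3).
rewrite (_ : (fun t => _) = x); last first.
  apply/funext => t; have p1a : 0 <= 1 + alpha by lra.
  have := @picard_sumE _ _ _ _ _ _ _ alpha0 tau0 k0 small 1 0 t p1a (lexx 0).
  by rewrite subr0 add0r /fracpow (mulrC (pospow _ _)) => <-.
move=> /(has_laplace_unique xv).
rewrite Gamma2 invr1 mul1r mulr1 wE.
have G : lam `^ (- (1 + 1)) > 0 by exact: powR_gt0.
(* The characteristic equation multiplied by lam^(-2 alpha). *)
have lE : lam `^ (- (2 * alpha)) * (a + b * expR (- (lam * tau))) - lam `^ (- alpha) = c.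
  have pD p q : lam `^ p * lam `^ q = lam `^ (p + q).
    by rewrite powRD// (gt_eqF l0) implybT.
  rewrite -lamE mulrDr (mulrCA _ c) !pD addNr powRr0 mulr1.
  by rewrite (_ : - (2 * alpha) + alpha = - alpha); ring.
(* By [lE] the transformed equation times [c] reads c v = c lam^(-2) + c v, forcing lam^(-2) = 0
   against [G]. *)
move=> vE; move: G; rewrite [ltRHS](_ : _ = 0) ?ltxx//.
have cv : c * v = c * lam `^ (- (1 + 1)) + (lam `^ (- (2 * alpha)) * (a + b * expR (- (lam * tau))) - lam `^ (- alpha)) * v.
  by rewrite {1}vE; field; rewrite (gt_eqF c0).
move: cv; rewrite lE -[LHS]add0r => /addIr /esym/eqP.
by rewrite mulf_eq0 (gt_eqF c0) /= => /eqP.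
Qed.

End instability.

Theorem mainTheorem4 (R : realType) (a b c alpha : R)
    (hc : 0 < c) (halpha : 1 / 2 < alpha < 1)
    (hb : `|b| < a + (cos (alpha * pi / 2)) ^+ 2 * (cos (alpha * pi))^-1 / (4 * c)) :
  stability_delay_independent a b c alpha.
Proof.
have /andP[h1 h2] := halpha.
have pi0 := pi_gt0 R.
(* The cosine is minus the sine of alpha pi - pi/2, an angle in [[0, pi]]. The weak sign suffices,
   since inversion preserves it, with 0 sent to 0. *)
have cos0 : cos (alpha * pi) <= 0.
  rewrite -(subrK (pi / 2) (alpha * pi)) cosDpihalf oppr_le0 sin_ge0_pi//.
  by apply/andP; split; nra.
have ba : `|b| < a.
  apply: (lt_le_trans hb); rewrite gerDl mulr_le0_ge0//.
    by rewrite mulr_ge0_le0 ?sqr_ge0// invr_le0.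
  by rewrite invr_ge0 mulr_ge0// ltW.
split=> [s0|_] tau tau0; last exact: unstable_delay.
(* The first half is vacuous: instability already holds at delay 0. *)
by case: (unstable_delay hc halpha (lexx 0) ba s0).
Qed.
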